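(* Let $L$ be a CW-complex and $\tau$ an infinite cardinal. The following conditions are equivalent: (1) $L$ is quasi-finite. (2) $\mathrm{e\text{-}dim}\,\beta X\leq L$ for every space $X$ with $\mathrm{e\text{-}dim}\,X\leq L$ (here $\beta X$ is the Čech–Stone compactification). (3) There exists an $L$-invertible map $f\colon Y_\tau\to \mathbb{I}^\tau$ such that $Y_\tau$ is a compact space of weight $\leq\tau$ with $\mathrm{e\text{-}dim}\,Y_\tau\leq L$. (4) For every $L$-connected pair $K\subset M$, where $K$ is a compact space of weight $\leq\tau$ and $M$ is an arbitrary space, there exists a compact set $P\subset M$ containing $K$ such that $w(P)\leq\tau$ and the pair $K\subset P$ is $L$-connected.
   Context: All spaces are Tychonoff and all maps are continuous; $w(X)$ denotes weight and $\mathbb{I}^\tau$ the Tychonoff cube of weight $\tau$. For spaces $X,Y$, $A\subset X$ and a map $g\colon A\to Y$: $Y\in ANE(g,A,X)$ means $g$ extends continuously to a neighborhood $U$ of $A$ in $X$ for which there is a continuous $h\colon X\to[0,1]$ with $h^{-1}((0,1])=U$ and $h(A)=\{1\}$. $Y\in AE(g,A,X)$ means the same with $U=X$. For a CW-complex $L$, $\mathrm{e\text{-}dim}\,X\leq L$ means: $L\in AE(g,A,X)$ for every closed $A\subset X$ and every map $g\colon A\to L$ with $L\in ANE(g,A,X)$. For a map $g\colon A\to P$ with $A\subset X$ closed, $A$ is normally placed in $X$ with respect to $(g,P)$ if for every continuous real function $h$ on $P$ the function $h\circ g$ extends continuously over $X$. A pair of spaces $K\subset P$ is $L$-connected if for every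 space $X$ with $\mathrm{e\text{-}dim}\,X\leq L$, every closed $A\subset X$ and every map $g\colon A\to K$ such that $A$ is normally placed in $X$ with respect to $(g,P)$, $g$ extends to a map $X\to P$. $L$ is quasi-finite if every finite subcomplex $K$ of $L$ is contained in a finite subcomplex $P$ of $L$ such that the pair $K\subset P$ is $L$-connected. A map $f\colon X\to Y$ is $L$-invertible if for every space $Z$ with $\mathrm{e\text{-}dim}\,Z\leq L$ and every map $g\colon Z\to Y$ there is a map $h\colon Z\to X$ with $f\circ h=g$. *)

(* Defs.v *)
From HB Require Import structures.
From mathcomp Require Import all_boot all_order all_algebra.
From mathcomp Require Import all_classical all_reals all_analysis.
From mathcomp Require Import Rstruct Rstruct_topology.

Set Implicit Arguments.
Unset Strict Implicit.
Unset Printing Implicit Defensive.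

Import Order.TTheory GRing.Theory Num.Theory.
Local Open Scope classical_set_scope.
Local Open Scope ring_scope.

Notation RR := Rdefinitions.R.

Definition unitI : set RR := [set x : RR | 0 <= x <= 1].
Definition unit_interval : topologicalType := set_type unitI.

Definition tych_cube (I : Type) : topologicalType := {ptws I -> unit_interval}.

Definition tychonoff_sp (X : topologicalType) : Prop :=
  hausdorff_space X /\
  forall (B : set X) (x : X), closed B -> ~ B x ->
    exists f : X -> RR, continuous f /\ f x = 0 /\ (forall y, B y -> f y = 1).

(* w(X) <= |I| : X has a base (of open sets) indexed by I.  For infinite I
   this is equivalent to the existence of a base of cardinality <= |I|. *)
Definition weight_le (X : topologicalType) (I : Type) : Prop :=
  exists b : I -> set X, (forall i, open (b i)) /\
    forall (U : set X) (x : X), open U -> U x -> exists i, b i x /\ b i `<=` U.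

Definition ANE (X Y : topologicalType) (A : set X) (g : set_type A -> Y) : Prop :=
  exists (U : set X) (h : X -> RR),
    continuous h /\ (forall x, 0 <= h x <= 1) /\
    U = [set x | 0 < h x] /\ (forall a : set_type A, h (set_val a) = 1) /\
    exists G : set_type U -> Y, continuous G /\
      forall (a : set_type A) (u : set_type U), set_val u = set_val a -> G u = g a.

(* Y \in AE(g, A, X)  (U = X; the function h is then the constant 1) *)
Definition AE (X Y : topologicalType) (A : set X) (g : set_type A -> Y) : Prop :=
  exists G : X -> Y, continuous G /\
    forall a : set_type A, G (set_val a) = g a.

Definition edim_le (X L : topologicalType) : Prop :=
  forall (A : set X) (g : set_type A -> L), closed A -> continuous g ->
    ANE g -> AE g.

Definition normally_placed (X P : topologicalType) (A : set X)
    (g : set_type A -> P) : Prop :=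
  forall h : P -> RR, continuous h ->
    exists H : X -> RR, continuous H /\
      forall a : set_type A, H (set_val a) = h (g a).

Definition L_connected (L P : topologicalType) (K : set P) : Prop :=
  forall (X : topologicalType), tychonoff_sp X -> edim_le X L ->
  forall (A : set X) (g : set_type A -> set_type K),
    closed A -> continuous g ->
    normally_placed (fun a => set_val (g a)) ->
    exists G : X -> P, continuous G /\
      forall a : set_type A, G (set_val a) = set_val (g a).

Definition L_invertible (L Y T : topologicalType) (f : Y -> T) : Prop :=
  forall (Z : topologicalType), tychonoff_sp Z -> edim_le Z L ->
  forall g : Z -> T, continuous g ->
    exists h : Z -> Y, continuous h /\ forall z, f (h z) = g z.

(* (Z, e) is a Cech-Stone compactification of X : Z is compact Hausdorff,
   e : X -> Z is a homeomorphic embedding with dense image, and every map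
   X -> [0,1] extends continuously over Z (Engelking, Thm 3.6.1 / Cor 3.6.2). *)
Definition stone_cech (X Z : topologicalType) (e : X -> Z) : Prop :=
  compact [set: Z] /\ hausdorff_space Z /\
  continuous e /\ injective e /\
  (forall U : set X, open U -> exists V : set Z, open V /\ e @` U = V `&` range e) /\
  (forall V : set Z, open V -> V !=set0 -> (V `&` range e) !=set0) /\
  (forall f : X -> unit_interval, continuous f ->
     exists F : Z -> unit_interval, continuous F /\ forall x, F (e x) = f x).

(* The closed n-disk is modelled as the closed unit ball of 'rV[R]_n
   (sup norm; homeomorphic to the Euclidean disk, with the sphere
   corresponding to the difference closed ball minus open ball). *)
Definition odisk (n : nat) : set 'rV[RR]_n := ball (0 : 'rV[RR]_n) 1.
Definition cdisk (n : nat) : set 'rV[RR]_n := closed_ball (0 : 'rV[RR]_n) 1.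
Arguments odisk n : clear implicits.
Arguments cdisk n : clear implicits.

Unset Implicit Arguments.
Record CW_structure (L : topologicalType) := {
  cw_cell : Type;
  cw_dim : cw_cell -> nat;
  cw_char : forall a : cw_cell, 'rV[RR]_(cw_dim a) -> L;
  cw_hausdorff : hausdorff_space L;
  cw_char_cont : forall a, {within cdisk (cw_dim a), continuous (cw_char a)};
  cw_cover : forall x : L, exists a, (cw_char a @` odisk (cw_dim a)) x;
  cw_disjoint : forall a b (x : L), (cw_char a @` odisk (cw_dim a)) x ->
                  (cw_char b @` odisk (cw_dim b)) x -> a = b;
  cw_inj : forall a, {in odisk (cw_dim a) &, injective (cw_char a)};
  cw_open : forall a (U : set 'rV[RR]_(cw_dim a)), open U ->
     exists V : set L, open V /\
       cw_char a @` (U `&` odisk (cw_dim a)) = V `&` (cw_char a @` odisk (cw_dim a));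
  cw_closure_finite : forall a, exists F : set cw_cell, finite_set F /\
     (forall b, F b -> (cw_dim b < cw_dim a)%N) /\
     cw_char a @` (cdisk (cw_dim a) `\` odisk (cw_dim a)) `<=`
       \bigcup_(b in F) (cw_char b @` odisk (cw_dim b));
  cw_weak : forall A : set L,
     (forall a, closed (cdisk (cw_dim a) `&` cw_char a @^-1` A)) -> closed A
}.
Set Implicit Arguments.
Arguments cw_cell {L}.
Arguments cw_dim {L c} : rename.
Arguments cw_char {L c} : rename.

Definition cw_ocell (L : topologicalType) (C : CW_structure L) (a : cw_cell C) : set L :=
  cw_char a @` odisk (cw_dim a).

Definition cw_carrier (L : topologicalType) (C : CW_structure L) (S : set (cw_cell C)) : set L :=
  \bigcup_(a in S) cw_ocell a.

Definition finite_subcomplex (L : topologicalType) (C : CW_structure L)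
    (S : set (cw_cell C)) : Prop :=
  finite_set S /\ closed (cw_carrier S).

Definition quasi_finite (L : topologicalType) (C : CW_structure L) : Prop :=
  forall K : set (cw_cell C), finite_subcomplex K ->
    exists P : set (cw_cell C), finite_subcomplex P /\ K `<=` P /\
      L_connected L [set p : set_type (cw_carrier P) | cw_carrier K (set_val p)].

(* Main.v *)
(* (1) -> (2): a map of a closed subset of beta X to L given near the subset
   takes values, on a closed neighbourhood, in a finite subcomplex K; its trace
   on X extends to a finite subcomplex P, and hence to beta X since P is compact.
   (2) -> (3): a map from a compact space of e-dim <= L to I^tau factors through a
   compact subset of R^J of e-dim <= L, with |J| = tau.  All such subsets form a
   set; the Stone-Cech compactification of their disjoint sum, factored in the
   same way, is Y.  (3) -> (4): embed K in I^tau, extend the map f^-1(K) -> K to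
   Y -> M, and take for P the image of Y.  (4) -> (1): apply (4) with M = L.

   Both the factorization and (4) -> (1) need that a finite CW complex P embeds in
   some R^m as a retract of a neighbourhood.  For the factorization, whether a map
   to P extends depends only on an approximation of it, so it suffices to close a
   family of tau real functions on X under a countable set of finitary operations
   that pick solutions of approximate extension problems. *)
Require Import Defs.
From HB Require Import structures.
From mathcomp Require Import all_boot all_order all_algebra.
From mathcomp Require Import all_classical all_reals all_analysis.
From mathcomp Require Import Rstruct Rstruct_topology.
From mathcomp Require Import ring lra.
Set Implicit Arguments.
Unset Strict Implicit.
Unset Printing Implicit Defensive.
Import Order.TTheory GRing.Theory Num.Theory.
Import numFieldNormedType.Exports.
Local Open Scope classical_set_scope.
Local Open Scope ring_scope.

(** * Topological preliminaries *)

(** [L] need not be compact, so a map to [L] need not extend over beta X; normal placement is what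
    replaces compactness of X. On a closed subset of a compact space it is automatic, by Tietze. For
    a map to a compact K in the cube I^tau it is what extends the tau coordinates over X, so that X
    is mapped to I^tau and an invertible map can be applied.

    In the factorization X may carry too many maps to P to keep them all. If two maps to the
    neighbourhood N of P in R^m lie, point by point, in a common ball contained in N, segments join
    them inside N and the retraction brings the segments back to P. So a solution that is only
    prescribed up to finitely many basic open sets can be corrected to agree exactly with the given
    map on the closed set. Finite problems over tau functions number tau, which is why the closed
    family is indexed by trees with leaves in I and nodes labelled by natural numbers. All factors
    lie in one R^J and reach the cube by one formula, so a single sum is universal for them. *)

Definition clamp01 (x : RR) : RR := Order.min 1 (Order.max 0 x).

Lemma continuous_clamp01 : continuous clamp01.
Proof.
move=> x; apply: (@continuous_min RR RR (fun=> 1) (fun x => Order.max 0 x)).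
  exact: cvg_cst.
by apply: (@continuous_max RR RR (fun=> 0) id); [exact: cvg_cst|exact: cvg_id].
Qed.

Lemma clamp01_itv x : 0 <= clamp01 x <= 1.
Proof.
by rewrite /clamp01 le_min ler01 le_max lexx /= ge_min lexx.
Qed.

Lemma clamp01_id x : 0 <= x <= 1 -> clamp01 x = x.
Proof. by rewrite /clamp01 => /andP[? ?]; rewrite max_r// min_r. Qed.

Lemma clamp01_le0 x : x <= 0 -> clamp01 x = 0.
Proof. by rewrite /clamp01 => x0; rewrite max_l// min_r. Qed.

Lemma clamp01_ge1 x : 1 <= x -> clamp01 x = 1.
Proof. by rewrite /clamp01 => x1; rewrite max_r ?min_l//; lra. Qed.

Lemma clamp01_gt0 x : (0 < clamp01 x) = (0 < x).
Proof.
rewrite /clamp01 lt_min ltr01 /=.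
by have [x0|x0] := leP x 0; rewrite ?ltxx.
Qed.

Lemma cvg_near_eq (X Y : topologicalType) (f g : X -> Y) (x : X) :
  {for x, continuous f} -> (\near x, f x = g x) -> {for x, continuous g}.
Proof.
move=> cf fg; rewrite /prop_for /continuous_at -(nbhs_singleton fg).
by apply: cvg_trans cf; apply: near_eq_cvg.
Qed.

Lemma continuous_cst_at (X Y : topologicalType) (c : Y) (x : X) :
  {for x, continuous (fun=> c)}.
Proof. exact: cvg_cst. Qed.

Lemma continuous_id_at (X : topologicalType) (x : X) :
  {for x, continuous (fun x : X => x)}.
Proof. exact: cvg_id. Qed.

Lemma continuous_pair_at (X Y Z : topologicalType) (f : X -> Y) (g : X -> Z) (x : X) :
  {for x, continuous f} -> {for x, continuous g} ->
  {for x, continuous (fun z => (f z, g z))}.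
Proof. by move=> cf cg; apply: cvg_pair. Qed.

Lemma continuous_comp_at (X Y Z : topologicalType) (f : X -> Y) (g : Y -> Z) (x : X) :
  {for x, continuous f} -> {for f x, continuous g} ->
  {for x, continuous (fun z => g (f z))}.
Proof. by move=> cf cg; exact: continuous_comp. Qed.

Lemma open_near (X : topologicalType) (U : set X) (x : X) :
  open U -> U x -> nbhs x U.
Proof. by move=> oU Ux; apply: open_nbhs_nbhs. Qed.

Lemma continuous_ext_at (X Y : topologicalType) (f g : X -> Y) (x : X) :
  {for x, continuous f} -> (forall z, f z = g z) -> {for x, continuous g}.
Proof. by move=> cf /funext <-. Qed.

Lemma within_constant (X Y : topologicalType) (A : set X) (f : X -> Y) (c : Y) :
  (forall x, A x -> f x = c) -> {within A, continuous f}.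
Proof.
move=> fc; apply: (@subspace_eq_continuous _ A Y (fun=> c)).
  by move=> x; rewrite inE => /fc.
by move=> x; exact: continuous_cst_at.
Qed.

Lemma continuous_near (X Y : topologicalType) (f : X -> Y) (U : set Y) (x : X) :
  {for x, continuous f} -> open U -> U (f x) -> nbhs x [set z | U (f z)].
Proof. by move=> cf oU Ux; apply: cf; exact: open_near. Qed.

Lemma continuous_lt (X : topologicalType) (f : X -> RR) (a : RR) :
  continuous f -> open [set x | a < f x].
Proof.
move=> cf; apply: (open_comp (f := f) (D := [set y | a < y])).
  by move=> ? _; exact: cf.
exact: open_gt.
Qed.

Lemma continuous_gt (X : topologicalType) (f : X -> RR) (a : RR) :
  continuous f -> open [set x | f x < a].
Proof.
move=> cf; apply: (open_comp (f := f) (D := [set y | y < a])).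
  by move=> ? _; exact: cf.
exact: open_lt.
Qed.

Lemma continuous_le (X : topologicalType) (f : X -> RR) (a : RR) :
  continuous f -> closed [set x | a <= f x].
Proof.
move=> cf; apply: (closed_comp (f := f) (D := [set y | a <= y])).
  by move=> ? _; exact: cf.
exact: closed_ge.
Qed.

Lemma closed_preimage (X Y : topologicalType) (f : X -> Y) (B : set Y) :
  continuous f -> closed B -> closed (f @^-1` B).
Proof. by move=> cf; apply: closed_comp => ? _; exact: cf. Qed.

Lemma open_preimage (X Y : topologicalType) (f : X -> Y) (B : set Y) :
  continuous f -> open B -> open (f @^-1` B).
Proof. by move=> cf; apply: open_comp => ? _; exact: cf. Qed.

Lemma continuous_set_val (X : topologicalType) (A : set X) :
  continuous (set_val : set_type A -> X).
Proof. exact: initial_continuous. Qed.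

Lemma continuous_val_comp (X Z : topologicalType) (A : set X) (f : Z -> set_type A) :
  continuous f -> continuous (fun z => set_val (f z)).
Proof.
move=> cf z; apply: (@continuous_comp_at _ _ _ f set_val); first exact: cf.
exact: continuous_set_val.
Qed.

Lemma continuous_to_set_type (X Z : topologicalType) (A : set X)
    (f : Z -> set_type A) :
  continuous (fun z => set_val (f z)) -> continuous f.
Proof.
move=> cf; apply/continuousP => _ [U oU <-].
exact: (open_preimage cf oU).
Qed.

Definition to_set (X : Type) (A : set X) (x : X) (Ax : A x) : set_type A :=
  exist _ x (mem_set Ax).

Lemma to_setK (X : Type) (A : set X) (x : X) (Ax : A x) :
  set_val (to_set Ax) = x.
Proof. by []. Qed.

Lemma set_val_mem (X : Type) (A : set X) (x : set_type A) : A (set_val x).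
Proof. exact: set_valP. Qed.

Lemma set_val_injective (X : Type) (A : set X) :
  injective (set_val : set_type A -> X).
Proof. exact: val_inj. Qed.

Lemma range_set_val (X : Type) (A : set X) :
  range (set_val : set_type A -> X) = A.
Proof.
apply/seteqP; split=> [_ [x _ <-]|x Ax]; first exact: set_val_mem.
by exists (to_set Ax).
Qed.

Lemma within_set_val (X Y : topologicalType) (A : set X) (f : X -> Y) :
  {within A, continuous f} <-> continuous (fun a : set_type A => f (set_val a)).
Proof. exact: subspace_sigL_continuousP. Qed.

Lemma valL_set_val (X Y : Type) (A : set X) (y : Y) (f : set_type A -> Y) a :
  valL_ y f (set_val a) = f a.
Proof. exact: (congr1 (fun u => u f a) (sigL_valL y)). Qed.

Lemma compact_set_type (X : topologicalType) (A : set X) :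
  compact [set: set_type A] <-> compact A.
Proof.
split=> [cA|cA].
  rewrite -(range_set_val A); apply: continuous_compact cA.
  exact/continuous_subspaceT/continuous_set_val.
move=> F FF _.
have FA : (set_val @ F) A by apply: (@filterE _ F) => x; exact: set_val_mem.
have [x [Ax clx]] := cA (set_val @ F) _ FA.
exists (to_set Ax); split=> // B C FB [_ [[U oU <-] /= Ux UC]].
have [_ [/= [y By <-] Uy]] := clx (set_val @` B) U (filterS (@preimage_image _ _ _ _) FB)
  (open_near oU Ux).
by exists y; split=> //; apply: UC.
Qed.

Lemma hausdorff_injective (X Y : topologicalType) (f : X -> Y) :
  continuous f -> injective f -> hausdorff_space Y -> hausdorff_space X.
Proof.
move=> cf injf hY x y clxy; apply: injf; apply: hY => U V Ux Vy.
by have [z [? ?]] := clxy _ _ (cf _ _ Ux) (cf _ _ Vy); exists (f z).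
Qed.

Lemma hausdorff_set_type (X : topologicalType) (A : set X) :
  hausdorff_space X -> hausdorff_space (set_type A).
Proof.
exact/hausdorff_injective/set_val_injective/continuous_set_val.
Qed.

Lemma normal_urysohn (X : topologicalType) (A B : set X) :
  normal_space X -> closed A -> closed B -> A `&` B = set0 ->
  exists f : X -> RR, [/\ continuous f, forall x, 0 <= f x <= 1,
    forall x, A x -> f x = 0 & forall x, B x -> f x = 1].
Proof.
move=> /(@normal_separatorP RR) nX cA cB AB0.
have /(@uniform_separatorP _ RR)[f [cf f01 f0 f1]] := nX _ _ cA cB AB0.
exists f; split=> // [x|x Ax|x Bx].
- by have /= := f01 (f x) (ex_intro2 _ _ x I erefl); rewrite in_itv.
- exact: f0 (imageP f Ax).
- exact: f1 (imageP f Bx).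
Qed.

Lemma normal_tychonoff (X : topologicalType) :
  hausdorff_space X -> normal_space X -> tychonoff_sp X.
Proof.
move=> hX nX; split=> // B x cB nBx.
have cx : closed [set x] by apply/accessible_closed_set1/hausdorff_accessible.
have [|f [cf _ f0 f1]] := normal_urysohn nX cx cB.
  by apply/seteqP; split=> // y [/= ->].
by exists f; split=> //; split=> //; exact: f0.
Qed.

Lemma compact_tychonoff (X : topologicalType) :
  hausdorff_space X -> compact [set: X] -> tychonoff_sp X.
Proof. by move=> hX cX; apply: normal_tychonoff => //; exact: compact_normal. Qed.

Definition to_unit (x : RR) : unit_interval := to_set (clamp01_itv x : unitI (clamp01 x)).

Lemma continuous_to_unit : continuous to_unit.
Proof. by apply: continuous_to_set_type; exact: continuous_clamp01. Qed.

Lemma to_unitK (u : unit_interval) : to_unit (set_val u) = u.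
Proof.
by apply: set_val_injective; rewrite to_setK clamp01_id//; exact: (set_val_mem u).
Qed.

Lemma tychonoff_unit (X : topologicalType) (B : set X) (x : X) :
  tychonoff_sp X -> closed B -> ~ B x -> exists f : X -> unit_interval,
    [/\ continuous f, set_val (f x) = 0 & forall y, B y -> set_val (f y) = 1].
Proof.
move=> [_ sX] cB /(sX _ _ cB)[f [cf [f0 f1]]].
exists (fun z => to_unit (f z)); split.
- move=> z; apply: (@continuous_comp_at _ _ _ f to_unit); first exact: cf.
  exact: continuous_to_unit.
- by rewrite to_setK f0 clamp01_le0.
- by move=> y /f1 fy; rewrite to_setK fy clamp01_ge1.
Qed.

(* In a Tychonoff space the topology is induced by the functions to [0,1]. *)
Lemma continuous_to_tychonoff (Z P : topologicalType) (f : Z -> P) :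
  tychonoff_sp P ->
  (forall phi : P -> unit_interval, continuous phi -> continuous (phi \o f)) ->
  continuous f.
Proof.
move=> tP cphi z U; rewrite nbhsE => -[V [oV Vz] VU].
have [|phi [cp p0 p1]] := tychonoff_unit tP (open_closedC oV) (x := f z).
  by apply.
have : nbhs z [set x | set_val (phi (f x)) < 1].
  apply: open_near; last by rewrite /= p0.
  apply: continuous_gt => x; apply: (@continuous_comp_at _ _ _ (phi \o f) set_val).
    exact: cphi.
  exact: continuous_set_val.
rewrite nbhs_simpl; apply: filterS => x /= px; apply: VU; apply: contrapT => nV.
by rewrite p1 ?ltxx in px.
Qed.

Lemma tietze (X : topologicalType) (A : set X) (f : X -> RR) :
  normal_space X -> closed A -> compact A -> {within A, continuous f} ->
  exists2 F : X -> RR, continuous F & forall x, A x -> F x = f x.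
Proof.
move=> nX clA cA cf.
have [M M0 fM] : exists2 M : RR, 0 < M & forall x, A x -> `|f x| <= M.
  have [M [_ /(_ (`|M| + 1)) bM]] := @compact_bounded _ RR^o _ (continuous_compact cf cA).
  exists (`|M| + 1); first by rewrite ltr_wpDl.
  move=> x Ax; apply: bM (imageP f Ax).
  by have := ler_norm M; lra.
have [F [FA cF _]] := continuous_bounded_extension nX clA M0 cf fM.
by exists F => // x Ax; rewrite FA ?inE.
Qed.

Lemma tietze_compact (X : topologicalType) (A : set X) (f : set_type A -> RR) :
  hausdorff_space X -> compact [set: X] -> closed A -> continuous f ->
  exists2 F : X -> RR, continuous F & forall a, F (set_val a) = f a.
Proof.
move=> hX cX clA cf.
have cA : compact A by apply: subclosed_compact cX _.
have [|F cF FA] := @tietze X A (valL_ 0 f) (compact_normal hX cX) clA cA.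
  exact/subspace_valL_continuousP'.
by exists F => // a; rewrite (FA _ (set_val_mem a)) valL_set_val.
Qed.

(** The image of [P] minus [O] is compact, hence closed, and misses [c]; its complement is [W]. This
    is closedness of maps on compact sets, one fibre at a time. *)
Lemma compact_fiber_nbhs (X T : topologicalType) (P : set X) (f : X -> T)
    (O : set X) (c : T) :
  hausdorff_space T -> compact P -> {within P, continuous f} -> open O ->
  (forall p, P p -> f p = c -> O p) ->
  exists2 W, nbhs c W & forall p, P p -> W (f p) -> O p.
Proof.
move=> hT cP cf oO cO.
have cPO : compact (P `\` O).
  by apply: compact_closedI => //; exact: open_closedC.
have cl : closed (f @` (P `\` O)).
  apply: compact_closed => //; apply: continuous_compact => //.
  by apply: continuous_subspaceW cf => ? [].
exists (~` (f @` (P `\` O))).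
  apply: open_near; first exact: closed_openC.
  by move=> [p [Pp nOp] pc]; apply: nOp; exact: cO.
move=> p Pp /= nW; apply: contrapT => nO; apply: nW.
by exists p.
Qed.

(** An injective map on a compact space is an embedding: the fibre of [j] over [j (q x)] is one
    point, so each neighbourhood of [q x] contains the [j]-preimage of a neighbourhood. *)
Lemma continuous_lift_compact (A K T : topologicalType) (j : K -> T) (q : A -> K) :
  hausdorff_space T -> compact [set: K] -> continuous j -> injective j ->
  continuous (j \o q) -> continuous q.
Proof.
move=> hT cK cj injj cq x U; rewrite nbhsE => -[V [oV Vx] VU].
have [||W Wc WV] := @compact_fiber_nbhs _ _ setT j V (j (q x)) hT cK _ oV.
- exact: continuous_subspaceT.
- by move=> p _ /injj ->.
by have := cq x W Wc; rewrite !nbhs_simpl /=; apply: filterS => z Wz; apply/VU/WV.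
Qed.

(** * Extension dimension in terms of total functions *)

Section EdimTotal.
Variables (L : topologicalType) (l0 : L).

(** A map given near [A] is represented by a total function that is continuous where [h] is
    positive, which spares subspace types. Clamping [h / c] to [0,1] gives the function that [ANE]
    asks for. *)
Lemma edim_extend (X : topologicalType) (A : set X) (g : X -> L) (h : X -> RR)
    (c : RR) :
  edim_le X L -> closed A -> continuous h -> 0 < c ->
  (forall x, A x -> c <= h x) ->
  (forall x, 0 < h x -> {for x, continuous g}) ->
  exists2 G : X -> L, continuous G & forall x, A x -> G x = g x.
Proof.
move=> eX clA ch c0 hA cg.
have cAg : continuous (fun a : set_type A => g (set_val a)).
  apply/within_set_val/continuous_in_subspaceT => x /[!inE] Ax.
  by apply: cg; apply: lt_le_trans (hA _ Ax).
have [|G [cG GA]] := eX A (fun a => g (set_val a)) clA cAg; last first.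
  by exists G => // x Ax; exact: (GA (to_set Ax)).
exists [set x | 0 < clamp01 (h x / c)], (fun x => clamp01 (h x / c)).
split.
  move=> x; apply: (@continuous_comp _ _ _ (fun x => h x / c) clamp01);
    last exact: continuous_clamp01.
  by apply: cvgM; [exact: ch|exact: cvg_cst].
split; first by move=> x; exact: clamp01_itv.
split=> //; split.
  move=> a; apply: clamp01_ge1.
  by rewrite ler_pdivlMr// mul1r; apply: hA; exact: set_val_mem.
exists (fun u => g (set_val u)); split; last by move=> a u ->.
apply/within_set_val/continuous_in_subspaceT => x /[!inE] /=.
by rewrite clamp01_gt0 => hc; apply: cg; move: hc; rewrite pmulr_lgt0// invr_gt0.
Qed.

(** The extension over [U] is made total by the value [l0] elsewhere; since [U] is open, continuity
    on the subspace is continuity at its points. *)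
Lemma edim_leI (X : topologicalType) :
  (forall (A : set X) (g : X -> L) (h : X -> RR), closed A -> continuous h ->
     (forall x, 0 <= h x <= 1) -> (forall x, A x -> h x = 1) ->
     (forall x, 0 < h x -> {for x, continuous g}) ->
     exists2 G : X -> L, continuous G & forall x, A x -> G x = g x) ->
  edim_le X L.
Proof.
move=> H A g clA cg [U [h [ch [h01 [EU [hA [G [cG GA]]]]]]]].
have oU : open U by rewrite EU; exact: continuous_lt.
have [|x hx|F cF FA] := H A (valL_ l0 G) h clA ch h01.
- by move=> x Ax; exact: (hA (to_set Ax)).
- have Ux : U x by rewrite EU.
  have : {within U, continuous (valL_ l0 G)} by exact/subspace_valL_continuousP'.
  by rewrite continuous_open_subspace// => /(_ x); apply; rewrite inE.
exists F; split=> // a.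
have Ua : U (set_val a) by rewrite EU /= hA.
rewrite (FA _ (set_val_mem a)) -(GA a (to_set Ua) erefl).
exact: (valL_set_val l0 G (to_set Ua)).
Qed.

End EdimTotal.

(** The empty map extends over the empty neighbourhood, with [h = 0], so it extends to a map from
    [X] to the empty [L]. *)
Lemma edim_empty (X L : topologicalType) :
  (L -> False) -> edim_le X L -> X -> False.
Proof.
move=> nL eX x.
have [||G _] := eX set0 (fun a => False_rect _ (set_val_mem a)) closed0;
  last exact: nL (G x).
- by move=> a; have := set_val_mem a.
- exists set0, (fun=> 0); split; first by move=> ?; exact: cvg_cst.
  split; first by move=> ?; rewrite lexx ler01.
  split; first by apply/seteqP; split=> // y /=; rewrite ltxx.
  split; first by move=> a; have := set_val_mem a.
  exists (fun a => False_rect _ (set_val_mem a)).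
  by split=> a; have := set_val_mem a.
Qed.

Lemma edim_of_empty (X L : topologicalType) : (X -> False) -> edim_le X L.
Proof.
move=> nX A g _ _ _; exists (fun x => False_rect _ (nX x)).
by split=> x; [case: (nX x)|case: (nX (set_val x))].
Qed.

(** * Attaching a cell to a Euclidean neighbourhood retract *)

Lemma cdiskE n (d : 'rV[RR]_n) : cdisk n d = (`|d| <= 1) :> Prop.
Proof. by rewrite /cdisk closed_ballE// /closed_ball_ /= sub0r normrN. Qed.

Lemma odiskE n (d : 'rV[RR]_n) : odisk n d = (`|d| < 1) :> Prop.
Proof. by rewrite /odisk -ball_normE /ball_ /= sub0r normrN. Qed.

Lemma cdisk_compact n : compact (cdisk n).
Proof.
apply: bounded_closed_compact; last exact: closed_ball_closed.
exists 1; split; first exact: num_real.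
by move=> M M1 d; rewrite cdiskE => /le_trans; apply; exact: ltW.
Qed.

(** Radial retraction onto the closed unit ball, without case distinction. *)
Definition disk_proj n (d : 'rV[RR]_n) : 'rV[RR]_n := (Order.max 1 `|d|)^-1 *: d.

Lemma norm_disk_proj n (d : 'rV[RR]_n) : `|disk_proj d| = Order.min 1 `|d|.
Proof.
rewrite /disk_proj normrZ; have [d1|d1] := leP `|d| 1.
  by rewrite invr1 normr1 mul1r.
by rewrite gtr0_norm ?invr_gt0 ?(lt_trans ltr01)// mulVf// gt_eqF// (lt_trans ltr01).
Qed.

Lemma disk_proj_le1 n (d : 'rV[RR]_n) : `|disk_proj d| <= 1.
Proof. by rewrite norm_disk_proj ge_min lexx. Qed.

Lemma disk_proj_id n (d : 'rV[RR]_n) : `|d| <= 1 -> disk_proj d = d.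
Proof. by move=> d1; rewrite /disk_proj max_l// invr1 scale1r. Qed.

Lemma disk_proj_ge1 n (d : 'rV[RR]_n) : 1 <= `|d| -> disk_proj d = `|d|^-1 *: d.
Proof. by move=> d1; rewrite /disk_proj max_r. Qed.

Lemma continuous_disk_proj n : continuous (@disk_proj n).
Proof.
move=> d.
apply: (@continuousZ RR _ _ (fun d : 'rV[RR]_n => (Order.max 1 `|d|)^-1) id);
  last exact: continuous_id_at.
apply: (@continuousV RR _ (fun d : 'rV[RR]_n => Order.max 1 `|d|)).
  by rewrite gt_eqF// lt_max ltr01.
apply: (@continuous_max RR _ (fun=> 1) (fun d => `|d|)); first exact: continuous_cst_at.
exact: norm_continuous.
Qed.

(** On the compact set [A] the map [chi] is closed, hence a quotient map onto its image, and
    continuity descends through it. *)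
Lemma within_image_continuous (D L T : topologicalType) (A : set D)
    (chi : D -> L) (f : L -> T) :
  hausdorff_space L -> compact A -> closed A -> {within A, continuous chi} ->
  {within A, continuous (f \o chi)} -> {within chi @` A, continuous f}.
Proof.
move=> hL cA clA cchi cf; apply/continuous_closedP => W cW.
have /continuous_closedP/(_ _ cW)/closed_subspaceP[V cV VW] := cf.
apply/closed_subspaceP; exists (chi @` (A `&` V)).
  apply: compact_closed => //; apply: continuous_compact.
    by apply: continuous_subspaceW cchi => ? [].
  exact: compact_closedI.
apply/seteqP; split=> [_ [[d [Ad Vd] <-] _]|q [Wq [d Ad dE]]].
  split; last by exists d.
  by have [] : ((f \o chi) @^-1` W `&` A) d by rewrite -VW.
split; last by exists d.
exists d => //; split=> //.
have : ((f \o chi) @^-1` W `&` A) d by split=> //=; rewrite dE.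
by rewrite -VW => -[].
Qed.

(** Close to [x] both branches are near the common value [f x], however [b] switches between them
    there. *)
Lemma continuous_if (X Y : topologicalType) (b : X -> bool) (f g : X -> Y) (x : X) :
  {for x, continuous f} -> {for x, continuous g} -> f x = g x ->
  {for x, continuous (fun z => if b z then f z else g z)}.
Proof.
move=> cf cg fg; rewrite /prop_for /continuous_at => U.
have -> : (if b x then f x else g x) = f x by case: (b x).
move=> Uf; have := cf U Uf; rewrite fg in Uf; have := cg U Uf.
by rewrite !nbhs_simpl /=; apply: filterS2 => z /=; case: (b z).
Qed.

(** [P] is a Euclidean neighbourhood retract: [phi] embeds it and [phi \o r] retracts [N] onto the
    image. Both maps are total, with arbitrary values outside [P] and [N]. *)
Definition euclidean_retract (L : topologicalType) (P : set L) :=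
  exists m (phi : L -> 'rV[RR]_m) (N : set 'rV[RR]_m) (r : 'rV[RR]_m -> L),
  [/\ {within P, continuous phi}, open N,
      forall v, N v -> {for v, continuous r} /\ P (r v) &
      forall p, P p -> N (phi p) /\ r (phi p) = p].

Section CellAttachment.
Variables (L : topologicalType) (hL : hausdorff_space L) (P0 : set L).
Hypothesis cP0 : compact P0.
Variables (n : nat) (chi : 'rV[RR]_n -> L).
Hypothesis chi_cont : {within cdisk n, continuous chi}.
Hypothesis chi_bd : forall d, `|d| = 1 -> P0 (chi d).
Hypothesis chi_int : forall d, `|d| < 1 -> ~ P0 (chi d).
Hypothesis chi_inj : forall d e, `|d| < 1 -> `|e| < 1 -> chi d = chi e -> d = e.
Variables (E0 : normedModType RR) (phi0 : L -> E0) (N0 : set E0) (r0 : E0 -> L).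
Hypothesis phi0_cont : {within P0, continuous phi0}.
Hypothesis N0_open : open N0.
Hypothesis r0_cont : forall y, N0 y -> {for y, continuous r0}.
Hypothesis r0_P0 : forall y, N0 y -> P0 (r0 y).
Hypothesis phi0_N0 : forall p, P0 p -> N0 (phi0 p).
Hypothesis r0K : forall p, P0 p -> r0 (phi0 p) = p.

Local Notation E := (E0 * RR * 'rV[RR]_n)%type.
Let P := P0 `|` chi @` cdisk n.

Let chi' d := chi (disk_proj d).

Let chi'_cont : continuous chi'.
Proof.
have inD d : cdisk n (disk_proj d) by rewrite cdiskE disk_proj_le1.
move: chi_cont => /within_set_val cc.
move=> d.
apply: (@continuous_comp_at _ _ _ (fun d => to_set (inD d)) (fun a => chi (set_val a)));
  last exact: cc.
have c : continuous (fun d => to_set (inD d)).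
  by apply: continuous_to_set_type; exact: continuous_disk_proj.
exact: c.
Qed.

(* Constant on the rays [|d| >= 1/2], so that pushing a point of the cell
   radially to the sphere does not change [theta]. *)
Let theta (d : 'rV[RR]_n) : E0 :=
  clamp01 (4 * `|d| - 1) *: phi0 (chi (`|d|^-1 *: d)).

Let norm_unit (d : 'rV[RR]_n) : 0 < `|d| -> `| `|d|^-1 *: d| = 1.
Proof.
by move=> d0; rewrite normrZ gtr0_norm ?invr_gt0// mulVf// gt_eqF.
Qed.

Let thetaE d : 1/2 <= `|d| -> theta d = phi0 (chi (`|d|^-1 *: d)).
Proof. by move=> d1; rewrite /theta clamp01_ge1 ?scale1r//; lra. Qed.

Let theta_ray d a : 1 <= a -> 1/2 <= `|d| -> theta (a *: d) = theta d.
Proof.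
move=> a1 d1; have a0 : 0 < a by lra.
have ad : `|a *: d| = a * `|d| by rewrite normrZ gtr0_norm.
rewrite thetaE; last by rewrite ad; nra.
rewrite thetaE// ad scalerA invfM mulrAC mulVf ?gt_eqF// mul1r //.
Qed.

Let theta_proj d : 1/2 <= `|d| -> theta (disk_proj d) = theta d.
Proof.
move=> d1; have [dl|dl] := leP `|d| 1; first by rewrite disk_proj_id.
have dd : `|disk_proj d| = 1 by rewrite norm_disk_proj min_l// ltW.
rewrite -[in RHS](_ : `|d| *: disk_proj d = d); last first.
  rewrite disk_proj_ge1 ?ltW// scalerA divff ?scale1r// gt_eqF//; lra.
apply/esym/theta_ray; first exact: ltW.
by rewrite dd; lra.
Qed.

Let theta_cont : continuous theta.
Proof.
move=> d; have [d1|d1] := ltP `|d| (1/4).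
  apply: (@cvg_near_eq 'rV[RR]_n E0 (fun=> 0)); first exact: continuous_cst_at.
  have : nbhs d [set d | `|d| < 1/4].
    by apply: open_near => //; apply: continuous_gt => ?; exact: norm_continuous.
  apply: filterS => e /= e1; rewrite /theta clamp01_le0 ?scale0r//; lra.
apply: (@continuousZ RR _ _ (fun d : 'rV[RR]_n => clamp01 (4 * `|d| - 1))
  (fun d => phi0 (chi (`|d|^-1 *: d)))).
  apply: (@continuous_comp_at _ _ _ (fun d : 'rV[RR]_n => 4 * `|d| - 1) clamp01);
    last exact: continuous_clamp01.
  apply: (@continuousB RR RR^o _ (fun d : 'rV[RR]_n => 4 * `|d|));
    last exact: continuous_cst_at.
  apply: (@continuousM RR _ (fun=> 4) (fun d : 'rV[RR]_n => `|d|));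
    [exact: continuous_cst_at|exact: norm_continuous].
(* [phi0] is continuous only within [P0], so near [d] the map [chi (e / |e|)] is replaced by [pu],
   all of whose values lie in [P0]. As 1/8 is below 1/4, it bounds the denominator of [u] away from
   0 and still leaves [u e = e / |e|] near [d]. *)
pose u (e : 'rV[RR]_n) := (Order.max (1/8) `|e|)^-1 *: e.
pose pu e := if pselect (P0 (chi' (u e))) then chi' (u e) else chi' (u d).
have ue e : 1/8 < `|e| -> P0 (chi' (u e)) /\ chi' (u e) = chi (`|e|^-1 *: e).
  move=> e1; have e0 : 0 < `|e| by lra.
  by rewrite /u max_r ?ltW// /chi' disk_proj_id ?norm_unit//; split=> //;
    apply: chi_bd; exact: norm_unit.
have [pd _] : P0 (chi' (u d)) /\ chi' (u d) = chi (`|d|^-1 *: d) by apply: ue; lra.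
have Ppu e : P0 (pu e) by rewrite /pu; case: pselect.
have near8 : nbhs d [set e | 1/8 < `|e|].
  apply: open_near => /=; last by lra.
  by apply: continuous_lt => ?; exact: norm_continuous.
have cpu : {for d, continuous pu}.
  apply: (@cvg_near_eq _ _ (fun e => chi' (u e))).
    apply: (@continuous_comp_at _ _ _ u chi'); last exact: chi'_cont.
    apply: (@continuousZ RR _ _ (fun e : 'rV[RR]_n => (Order.max (1/8) `|e|)^-1) id);
      last exact: continuous_id_at.
    apply: (@continuousV RR _ (fun e : 'rV[RR]_n => Order.max (1/8) `|e|)).
      by rewrite gt_eqF// lt_max; apply/orP; left; lra.
    apply: (@continuous_max RR _ (fun=> 1/8) (fun d => `|d|));
      first exact: continuous_cst_at.
    exact: norm_continuous.
  apply: filterS near8 => e /ue[Pe _]; rewrite /pu.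
  by case: pselect.
have cphi : {for d, continuous (phi0 \o pu)}.
  move: phi0_cont => /subspace_continuousP/(_ _ (Ppu d)) c U /c.
  rewrite !nbhs_simpl /= => /cpu; rewrite nbhs_simpl /=.
  by apply: filterS => e; apply; exact: Ppu.
apply: cvg_near_eq cphi _.
apply: filterS near8 => e /ue[Pe eE]; rewrite /= /pu.
by case: pselect => //= _; rewrite eE.
Qed.

(** Coordinates [(y, t, w)] of the cell point [chi d]: [t = 1 - |d|] is positive inside the cell and
    0 on [P0], and [w / t] recovers [d]. For |d| >= 1/2 the first coordinate is the [phi0]-image of
    the radial projection to the boundary, which makes the two formulas agree on the sphere. *)
Let Phi (p : L) : E :=
  if pselect (P0 p) then (phi0 p, 0, 0) else
  let d := xget 0 [set d | `|d| < 1 /\ chi d = p] in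
  (theta d, 1 - `|d|, (1 - `|d|) *: d).

Let Phi_P0 p : P0 p -> Phi p = (phi0 p, 0, 0).
Proof. by rewrite /Phi; case: pselect. Qed.

Let Phi_chi d : `|d| <= 1 -> Phi (chi d) = (theta d, 1 - `|d|, (1 - `|d|) *: d).
Proof.
rewrite le_eqVlt => /orP[/eqP d1|d1].
  rewrite Phi_P0 ?thetaE; last by apply: chi_bd.
    by rewrite d1 subrr scale0r invr1 scale1r.
  by rewrite d1; lra.
rewrite /Phi; case: pselect => [/(chi_int d1)//|_] /=.
have [e1 ed] := @xgetI _ 0 [set e | `|e| < 1 /\ chi e = chi d] d (conj d1 erefl).
by rewrite (chi_inj e1 d1 ed).
Qed.

Let Phi_cont : {within P, continuous Phi}.
Proof.
apply: withinU_continuous.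
- exact: compact_closed.
- apply: compact_closed => //; apply: continuous_compact => //.
  exact: cdisk_compact.
- apply: (@subspace_eq_continuous _ _ _ (fun p => (phi0 p, 0, 0) : E)).
    by move=> p /[!inE] /Phi_P0.
  move=> p.
  have c1 : {for p, continuous (fun p : subspace P0 => (phi0 p, 0 : RR))}.
    apply: (@continuous_pair_at (subspace P0) _ RR phi0 (fun=> 0)).
      exact: phi0_cont.
    exact: continuous_cst_at.
  exact: continuous_pair_at c1 (@continuous_cst_at _ _ (0 : 'rV[RR]_n) p).
- apply: within_image_continuous => //.
  + exact: cdisk_compact.
  + exact: closed_ball_closed.
  apply: (@subspace_eq_continuous _ _ _
    (fun d => (theta d, 1 - `|d|, (1 - `|d|) *: d) : E)).
    by move=> d; rewrite inE cdiskE => /Phi_chi.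
  apply: continuous_subspaceT => d.
  have c1 : {for d, continuous (fun d : 'rV[RR]_n => 1 - `|d|)}.
    apply: (@continuousB RR RR^o); first exact: continuous_cst_at.
    exact: norm_continuous.
  apply: (@continuous_pair_at _ (E0 * RR)%type _
    (fun d => (theta d, 1 - `|d|)) (fun d => (1 - `|d|) *: d)).
    by apply: (@continuous_pair_at _ _ RR); [exact: theta_cont|exact: c1].
  exact: (@continuousZ RR _ _ (fun d : 'rV[RR]_n => 1 - `|d|) id _ c1
    (@continuous_id_at _ _)).
Qed.

Let dir (v : E) : 'rV[RR]_n := disk_proj (v.1.2^-1 *: v.2).
Let delta (v : E) : RR :=
  (`|v.1.1 - theta (dir v)| + `|1 - `|dir v| - v.1.2|) / v.1.2.
Let push (v : E) : E0 :=
  v.1.1 + (1 - clamp01 (delta v - 1)) *: (theta (dir v) - v.1.1).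
(* For [v = (y, t, w)] with [t > 0], [delta v] measures, relative to [t], how far
   [v] is from the image of the cell point [chi (dir v)].  While it grows from 0
   to 1 that point is pushed radially to the sphere; from 1 to 2 it moves along
   the image under [r0] of the segment to [y]. *)
Let retr (v : E) : L :=
  if v.1.2 <= 0 then r0 v.1.1 else
  if delta v <= 1 then chi' ((1 + delta v) *: dir v) else r0 (push v).

Let fst1_cont (v : E) : {for v, continuous (fun v : E => v.1.1)}.
Proof. by apply: (@continuous_comp_at E _ _ fst fst); exact: cvg_fst. Qed.

Let snd1_cont (v : E) : {for v, continuous (fun v : E => v.1.2)}.
Proof. by apply: (@continuous_comp_at E _ _ fst snd); [exact: cvg_fst|exact: cvg_snd]. Qed.

Let snd_cont (v : E) : {for v, continuous (fun v : E => v.2)}.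
Proof. exact: cvg_snd. Qed.

Let dir_cont (v : E) : 0 < v.1.2 -> {for v, continuous dir}.
Proof.
move=> t0; apply: (@continuous_comp_at _ _ _ (fun v : E => v.1.2^-1 *: v.2));
  last exact: continuous_disk_proj.
apply: (@continuousZ RR _ _ (fun v : E => v.1.2^-1) (fun v : E => v.2)).
  by apply: (@continuousV RR _ (fun v : E => v.1.2)); rewrite ?gt_eqF.
exact: snd_cont.
Qed.

Let delta_cont (v : E) : 0 < v.1.2 -> {for v, continuous delta}.
Proof.
move=> t0; have cd := dir_cont t0.
have c1 : {for v, continuous (fun v : E => `|v.1.1 - theta (dir v)|)}.
  apply: (@continuous_comp_at _ _ _ (fun v : E => v.1.1 - theta (dir v)) (fun z => `|z|));
    last exact: norm_continuous.
  apply: (@continuousB RR _ _ (fun v : E => v.1.1) (fun v : E => theta (dir v))).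
    exact: fst1_cont.
  by apply: (continuous_comp_at cd); exact: theta_cont.
have c2 : {for v, continuous (fun v : E => `|1 - `|dir v| - v.1.2|)}.
  apply: (@continuous_comp_at _ _ _ (fun v : E => 1 - `|dir v| - v.1.2) (fun z => `|z|));
    last exact: (@norm_continuous RR RR^o).
  apply: (@continuousB RR RR^o _ (fun v : E => 1 - `|dir v|) (fun v : E => v.1.2));
    last exact: snd1_cont.
  apply: (@continuousB RR RR^o _ (fun=> 1) (fun v : E => `|dir v|)).
    exact: continuous_cst_at.
  by apply: (continuous_comp_at cd); exact: norm_continuous.
apply: (@continuousM RR _ (fun v : E => `|v.1.1 - theta (dir v)| + `|1 - `|dir v| - v.1.2|)
  (fun v : E => v.1.2^-1)).
  exact: (@continuousD RR RR^o _ _ _ _ c1 c2).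
by apply: (@continuousV RR _ (fun v : E => v.1.2)); rewrite ?gt_eqF.
Qed.

Let branch1_cont (v : E) : 0 < v.1.2 ->
  {for v, continuous (fun v => chi' ((1 + delta v) *: dir v))}.
Proof.
move=> t0; apply: (@continuous_comp_at _ _ _ (fun v => (1 + delta v) *: dir v) chi');
  last exact: chi'_cont.
apply: (@continuousZ RR _ _ (fun v => 1 + delta v) dir); last exact: dir_cont.
apply: (@continuousD RR RR^o _ (fun=> 1) delta); first exact: continuous_cst_at.
exact: delta_cont.
Qed.

Let push_cont (v : E) : 0 < v.1.2 -> {for v, continuous push}.
Proof.
move=> t0; apply: (@continuousD RR _ _ (fun v : E => v.1.1)
  (fun v : E => (1 - clamp01 (delta v - 1)) *: (theta (dir v) - v.1.1))).
  exact: fst1_cont.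
apply: (@continuousZ RR _ _ (fun v => 1 - clamp01 (delta v - 1))
  (fun v : E => theta (dir v) - v.1.1)).
  apply: (@continuousB RR RR^o _ (fun=> 1) (fun v => clamp01 (delta v - 1))).
    exact: continuous_cst_at.
  apply: (@continuous_comp_at _ _ _ (fun v => delta v - 1) clamp01);
    last exact: continuous_clamp01.
  apply: (@continuousB RR RR^o _ delta (fun=> 1)); last exact: continuous_cst_at.
  exact: delta_cont.
apply: (@continuousB RR _ _ (fun v : E => theta (dir v)) (fun v : E => v.1.1)).
  by apply: (continuous_comp_at (dir_cont t0)); exact: theta_cont.
exact: fst1_cont.
Qed.

Let near_pos (v : E) : 0 < v.1.2 -> nbhs v [set v : E | 0 < v.1.2].
Proof.
by move=> t0; apply: open_near => //; apply: continuous_lt => ?; exact: snd1_cont.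
Qed.

Let delta_bound (v : E) c : 0 < v.1.2 -> delta v <= c ->
  `|v.1.1 - theta (dir v)| <= c * v.1.2 /\ 1 - `|dir v| <= (1 + c) * v.1.2.
Proof.
move=> t0; rewrite /delta ler_pdivrMr// => dc.
have := normr_ge0 (v.1.1 - theta (dir v)).
have := normr_ge0 (1 - `|dir v| - v.1.2).
have := ler_norm (1 - `|dir v| - v.1.2).
by split; lra.
Qed.

(** For [delta v >= 2] the point [push v] is [v.1.1]; before that it lies on a segment of length at
    most [2 t]. So [push] approaches the first coordinate as [t] tends to 0. *)
Let push_bound (v : E) : 0 < v.1.2 -> `|push v - v.1.1| <= 2 * v.1.2.
Proof.
move=> t0; rewrite /push addrAC subrr add0r.
have [d2|d2] := leP (delta v) 2; last first.
  by rewrite clamp01_ge1 ?subrr ?scale0r ?normr0 ?mulr_ge0 ?ltW//; lra.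
have [b1 _] := delta_bound t0 d2.
rewrite normrZ distrC in b1 *.
have /andP[c0 c1] := clamp01_itv (delta v - 1).
have c2 : `|1 - clamp01 (delta v - 1)| <= 1 by rewrite ger0_norm; lra.
have := normr_ge0 (theta (dir v) - v.1.1).
by have := normr_ge0 (1 - clamp01 (delta v - 1)); nra.
Qed.

Let delta_ge0 (v : E) : 0 < v.1.2 -> 0 <= delta v.
Proof. by move=> t0; rewrite /delta divr_ge0 ?addr_ge0// ltW. Qed.

Let dir_le1 (v : E) : `|dir v| <= 1. Proof. exact: disk_proj_le1. Qed.

Let chi'_P d : P (chi' d).
Proof. by right; exists (disk_proj d) => //; rewrite cdiskE disk_proj_le1. Qed.

(* The cell coordinates of [chi d] are recovered as [d = w / t]. *)
Let dirPhi d : `|d| < 1 -> dir (Phi (chi d)) = d /\ delta (Phi (chi d)) = 0.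
Proof.
move=> d1; rewrite Phi_chi ?ltW//.
have dE : dir (theta d, 1 - `|d|, (1 - `|d|) *: d) = d.
  rewrite /dir /= scalerA mulVf ?scale1r; last by rewrite subr_eq0 gt_eqF.
  by rewrite disk_proj_id ?ltW.
by rewrite /delta dE /= !subrr !normr0 addr0 mul0r.
Qed.

Let Phi_in (p : L) : P p -> Phi p = (phi0 p, 0, 0) /\ P0 p \/
  exists2 d, `|d| < 1 & p = chi d.
Proof.
move=> [Pp|[d + <-]]; first by left; rewrite Phi_P0.
rewrite cdiskE le_eqVlt => /orP[/eqP/chi_bd Pd|d1]; last by right; exists d.
by left; rewrite Phi_P0.
Qed.

Let retrK p : P p -> retr (Phi p) = p.
Proof.
move=> /Phi_in[[-> Pp]|[d d1 ->]]; first by rewrite /retr /= lexx r0K.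
have [dE d0] := dirPhi d1.
have t0 : 0 < (Phi (chi d)).1.2 by rewrite Phi_chi ?ltW//= subr_gt0.
by rewrite /retr leNgt t0 /= d0 ler01 dE addr0 scale1r /chi' disk_proj_id// ltW.
Qed.

Let good := [set v : E | {for v, continuous retr} /\ P (retr v)].

Let good_cell d : `|d| < 1 -> nbhs (Phi (chi d)) good.
Proof.
move=> d1; have [dE d0] := dirPhi d1.
have t0 : 0 < (Phi (chi d)).1.2 by rewrite Phi_chi ?ltW//= subr_gt0.
have nd : nbhs (Phi (chi d)) [set v | delta v < 1].
  apply: (continuous_near (delta_cont t0) (@open_lt _ 1)).
  by rewrite /= d0 ltr01.
have near1 v : 0 < v.1.2 -> delta v < 1 -> retr v = chi' ((1 + delta v) *: dir v).
  by move=> tv dv; rewrite /retr leNgt tv /= ltW.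
have ni : nbhs (Phi (chi d)) ([set v | 0 < v.1.2] `&` [set v | delta v < 1]).
  exact: filterI (near_pos t0) nd.
apply: filterS (nbhs_interior ni) => v nv; have [tv dv] := nbhs_singleton nv.
split; last by rewrite near1.
apply: cvg_near_eq (branch1_cont tv) _.
by apply: filterS nv => w [tw dw]; rewrite near1.
Qed.

Let good_base p : P0 p -> nbhs (phi0 p, 0 : RR, 0 : 'rV[RR]_n) good.
Proof.
move=> Pp; set y0 := phi0 p.
have [e e0 eN] : exists2 e : RR, 0 < e & forall y, `|y - y0| < 2 * e -> N0 y.
  have /nbhs_ballP[e /= e0 eN] : nbhs y0 N0 by apply: open_near; [|exact: phi0_N0].
  exists (e / 2); first by rewrite divr_gt0.
  move=> y ye; apply: eN; rewrite -ball_normE /ball_ /= distrC.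
  by rewrite mulrCA divff ?mulr1// in ye.
(* With [t < e / 4], [push] moves the first coordinate by less than [e / 2], so it stays in [N0].
   With [t < 1/8], the equation [delta v = 1] forces [1 - |dir v| < 1/4], so [dir v] lies where
   [theta] is constant on rays. *)
pose V := [set v : E | [/\ `|v.1.1 - y0| < e, `|v.1.2| < e / 4 & `|v.1.2| < 1/8]].
have nV : nbhs (y0, 0 : RR, 0 : 'rV[RR]_n) V.
  have c1 : continuous (fun v : E => `|v.1.1 - y0|).
    move=> v; apply: (@continuous_comp_at _ _ _ (fun v : E => v.1.1 - y0) (fun z => `|z|));
      last exact: norm_continuous.
    apply: (@continuousB RR _ _ (fun v : E => v.1.1) (fun=> y0)).
      exact: fst1_cont.
    exact: continuous_cst_at.
  have c2 : continuous (fun v : E => `|v.1.2|).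
    move=> v; apply: (@continuous_comp_at _ _ _ (fun v : E => v.1.2) (fun z => `|z|)).
      exact: snd1_cont.
    exact: (@norm_continuous RR RR^o).
  have n1 v (h : `|v.1.1 - y0| < e) := open_near (continuous_gt e c1) h.
  have n2 v (h : `|v.1.2| < e / 4) := open_near (continuous_gt (e / 4) c2) h.
  have n3 v (h : `|v.1.2| < 1/8) := open_near (continuous_gt (1/8) c2) h.
  apply: filterS (filterI (n1 _ _) (filterI (n2 _ _) (n3 _ _))) => /=.
  - by move=> v [? [? ?]].
  - by rewrite subrr normr0.
  - by rewrite normr0; lra.
  - by rewrite normr0; lra.
apply: filterS nV => v [v1 v2 v3].
have V0 w : `|w.1.1 - y0| < e -> `|w.1.2| < e / 4 -> N0 w.1.1 /\ (0 < w.1.2 -> N0 (push w)).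
  move=> w1 w2; split; first by apply: eN; lra.
  move=> tw; have := push_bound tw; rewrite ger0_norm ?ltW// in w2 => pb.
  apply: eN; have := ler_distD w.1.1 (push w) y0; lra.
have [N0v N0push] := V0 v v1 v2.
have [t0|t0|t0] := ltgtP v.1.2 0.
- have nt : nbhs v [set w : E | w.1.2 < 0].
    by apply: open_near => //; apply: continuous_gt => ?; exact: snd1_cont.
  have rE w : w.1.2 < 0 -> retr w = r0 w.1.1 by move=> w0; rewrite /retr ltW.
  split; last by rewrite rE//; left; exact: r0_P0.
  apply: (@cvg_near_eq _ _ (fun w : E => r0 w.1.1)).
    by apply: continuous_comp_at; [exact: fst1_cont|exact: r0_cont].
  by apply: filterS nt => w /rE.
- have rE w : 0 < w.1.2 ->
      retr w = if delta w <= 1 then chi' ((1 + delta w) *: dir w) else r0 (push w).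
    by move=> w0; rewrite /retr leNgt w0.
  split; last by rewrite rE//; case: ifP => _ //; left; exact/r0_P0/N0push.
  apply: (@cvg_near_eq _ _ (fun w =>
      if delta w <= 1 then chi' ((1 + delta w) *: dir w) else r0 (push w))); last first.
    by apply: filterS (near_pos t0) => w /rE.
  have cpush : {for v, continuous (fun w => r0 (push w))}.
    by apply: continuous_comp_at; [exact: push_cont|exact/r0_cont/N0push].
  have [dv|dv|dv] := ltgtP (delta v) 1.
  + apply: (cvg_near_eq (branch1_cont t0)).
    have nd : nbhs v [set w | delta w < 1].
      by apply: (continuous_near (delta_cont t0) (@open_lt _ 1)).
    by apply: filterS nd => w /= /ltW ->.
  + apply: (cvg_near_eq cpush).
    have nd : nbhs v [set w | 1 < delta w].
      by apply: (continuous_near (delta_cont t0) (@open_gt _ 1)).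
    by apply: filterS nd => w /=; rewrite ltNge => /negbTE ->.
  (* The branches meet on the sphere: [chi'] sends [2 *: dir v] to the boundary point
     [chi (dir v / |dir v|)], and [push v = theta (dir v)] is the [phi0]-image of that point. *)
  + apply: continuous_if => //; first exact: branch1_cont.
    have [|_ b2] := @delta_bound v 1 t0; first by rewrite dv.
    rewrite (ger0_norm (ltW t0)) in v3.
    have d1 : 1/2 <= `|dir v| by lra.
    have dpos : 0 < `|dir v| by lra.
    rewrite /push dv subrr clamp01_le0// subr0 scale1r subrKC thetaE// r0K;
      last by apply: chi_bd; exact: norm_unit.
    rewrite /chi' disk_proj_ge1; last by rewrite normrZ ger0_norm; lra.
    congr (chi _); rewrite normrZ ger0_norm; last by lra.
    by rewrite scalerA invfM mulrAC mulVf ?mul1r//; lra.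
(* Here the formulas with [t] in the denominator degenerate. Nearby points with [delta > 1] have
   [push] close to the first coordinate. Those with [delta <= 1] are sent to points of [P] whose
   first two coordinates under [Phi] are close to [(v.1.1, 0)], and compactness of [P] places all
   such points in [Q]. *)
- have rv : retr v = r0 v.1.1 by rewrite /retr t0 lexx.
  split; last by rewrite rv; left; exact: r0_P0.
  rewrite /prop_for /continuous_at rv => U; rewrite nbhsE => -[Q [oQ Qy] QU].
  have [e1 e10 e1O] : exists2 e1 : RR, 0 < e1 & forall y, `|y - v.1.1| < e1 -> Q (r0 y).
    have /nbhs_ballP[e1 /= e10 e1O] := r0_cont N0v (open_near oQ Qy).
    by exists e1 => // y ye; apply: e1O; rewrite -ball_normE /ball_ /= distrC.
  have cP : compact P.
    by apply: compactU => //; apply: continuous_compact => //; exact: cdisk_compact.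
  have hER : hausdorff_space (E0 * RR)%type by exact: (@norm_hausdorff RR (E0 * RR^o)%type).
  have cPhi1 : {within P, continuous (fun q => (Phi q).1)}.
    by move=> q; apply: (@continuous_comp_at (subspace P) _ _ Phi fst);
      [exact: Phi_cont|exact: cvg_fst].
  have [|W nW WO] := @compact_fiber_nbhs _ _ P (fun q => (Phi q).1) Q (v.1.1, 0) hER cP cPhi1 oQ.
    move=> q /Phi_in[[-> Pq] /= [qv]|[d d1 ->]].
      by rewrite -(r0K Pq) qv.
    by rewrite Phi_chi ?ltW//= => -[_ /eqP]; rewrite subr_eq0 gt_eqF.
  have [e2 e20 e2W] : exists2 e2 : RR, 0 < e2 &
      forall y s, `|y - v.1.1| < e2 -> `|s| < e2 -> W (y, s).
    have /nbhs_ballP[e2 /= e20 e2W] := nW.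
    exists e2 => // y s ye se; apply: e2W; split=> /=.
      by rewrite -ball_normE /ball_ /= distrC.
    by rewrite /ball /= sub0r normrN.
  (* The factor 4 leaves room for [3 * e3] in the bound on [push] and for [2 * e3] in those on
     [theta] and on [1 - |dir w|]. *)
  pose e3 := Order.min (1/8) (Order.min e1 e2) / 4.
  have m0 : 0 < Order.min (1/8) (Order.min e1 e2) by rewrite !lt_min e10 e20 andbT; lra.
  have [m1 m2 m3] : [/\ e3 * 4 <= 1/8, e3 * 4 <= e1 & e3 * 4 <= e2].
    by rewrite /e3 divfK// !ge_min !lexx !orbT.
  have e30 : 0 < e3 by rewrite /e3 divr_gt0.
  have nw : nbhs v [set w : E | `|w.1.1 - v.1.1| < e3 /\ `|w.1.2| < e3].
    have n1 : nbhs v [set w : E | `|w.1.1 - v.1.1| < e3].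
      have nb : nbhs v.1.1 [set y | `|y - v.1.1| < e3].
        apply/nbhs_ballP; exists e3 => // y.
        by rewrite -ball_normE /ball_ /= distrC.
      exact: (fst1_cont nb).
    have n2 : nbhs v [set w : E | `|w.1.2| < e3].
      have nb : nbhs v.1.2 [set s : RR | `|s| < e3].
        rewrite t0; apply/nbhs_ballP; exists e3 => // y.
        by rewrite /ball /= sub0r normrN.
      exact: (snd1_cont nb).
    exact: filterS (filterI n1 n2).
  rewrite nbhs_simpl /=; apply: filterS nw => w [w1 w2] /=; apply: QU.
  have [tw|tw] := leP w.1.2 0.
    by rewrite /retr tw; apply: e1O; lra.
  have wt : w.1.2 < e3 by rewrite ger0_norm ?ltW// in w2.
  rewrite /retr leNgt tw /=; case: leP => dw; last first.
    apply: e1O; have := ler_distD w.1.1 (push w) v.1.1; have := push_bound tw; lra.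
  have [b1 b2] := delta_bound tw dw.
  have d12 : 1/2 <= `|dir w| by lra.
  have dl := dir_le1 w; have dg := delta_ge0 tw.
  apply: WO; first exact: chi'_P.
  rewrite /chi' Phi_chi ?disk_proj_le1//=.
  have nd : `|(1 + delta w) *: dir w| = (1 + delta w) * `|dir w|.
    by rewrite normrZ ger0_norm//; lra.
  rewrite theta_proj; last by rewrite nd; nra.
  rewrite theta_ray//; last by lra.
  apply: e2W.
    have := ler_distD w.1.1 (theta (dir w)) v.1.1.
    rewrite [`|theta _ - w.1.1|]distrC; lra.
  rewrite norm_disk_proj nd.
  have : `|dir w| <= Order.min 1 ((1 + delta w) * `|dir w|).
    by rewrite le_min dl /=; nra.
  have : Order.min 1 ((1 + delta w) * `|dir w|) <= 1 by rewrite ge_min lexx.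
  by move=> a1 a2; rewrite ger0_norm; lra.
Qed.

Lemma cell_attachment_retract : exists (phi : L -> E) (N : set E) (r : E -> L),
  [/\ {within P, continuous phi}, open N,
      forall v, N v -> {for v, continuous r} /\ P (r v) &
      forall p, P p -> N (phi p) /\ r (phi p) = p].
Proof.
exists Phi, (interior good), retr; split.
- exact: Phi_cont.
- exact: open_interior.
- by move=> v /interior_subset.
- move=> p Pp; split; last exact: retrK.
  have [[-> P0p]|[d d1 ->]] := Phi_in Pp; first exact: good_base.
  exact: good_cell.
Qed.
End CellAttachment.

(** * CW complexes *)

Lemma finite_setE (T : Type) (A : set T) :
  finite_set A -> exists s : seq T, forall x, A x <-> List.In x s.
Proof.
elim/Peq : T => T in A *; move=> /finite_seqP[s ->]; exists s => x.
by elim: s => //= y s <-; rewrite in_cons; split=> [/orP[/eqP ->|]|[->|->]];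
  rewrite ?eqxx ?orbT; [left|right|..].
Qed.

(** The element removed has maximal [dim]: in a subcomplex it is a top cell, so that what remains is
    again a subcomplex. *)
Lemma finite_set_ind_dim (T : Type) (dim : T -> nat) (Pr : set T -> Prop) :
  Pr set0 ->
  (forall S a, finite_set S -> S a -> (forall b, S b -> (dim b <= dim a)%N) ->
     Pr (S `\ a) -> Pr S) ->
  forall S, finite_set S -> Pr S.
Proof.
elim/Peq : T => T in dim Pr *; move=> P0 PS S /finite_seqP[s0 ->].
pose r := fun x y : T => (dim y <= dim x)%N.
have rtr : transitive r by move=> y x z xy yz; exact: leq_trans yz xy.
have -> : [set` s0] = [set` sort r (undup s0)].
  by apply/seteqP; split=> x /=; rewrite mem_sort mem_undup.
have : sorted r (sort r (undup s0)) by apply: sort_sorted => x y; exact: leq_total.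
have : uniq (sort r (undup s0)) by rewrite sort_uniq undup_uniq.
elim: (sort _ _) => [_ _|a s IH /= /andP[nas us] srt].
  by rewrite (_ : [set` _] = set0) //; apply/seteqP; split.
have /allP amax := order_path_min rtr srt.
apply: (PS _ a).
- exact: finite_seq.
- by rewrite /= mem_head.
- by move=> b /=; rewrite in_cons => /orP[/eqP ->//|/amax].
rewrite (_ : _ `\ a = [set` s]); first by apply: IH => //; exact: path_sorted srt.
apply/seteqP; split=> [x /= []|x /= xs].
  by rewrite in_cons => /orP[/eqP|].
by rewrite in_cons xs orbT; split=> // xa; rewrite -xa xs in nas.
Qed.

Lemma finite_set_ind (T : Type) (Pr : set T -> Prop) :
  Pr set0 -> (forall S a, finite_set (S `\ a) -> S a -> Pr (S `\ a) -> Pr S) ->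
  forall S, finite_set S -> Pr S.
Proof.
move=> P0 PS; apply: (@finite_set_ind_dim _ (fun=> 0%N)) => // S a fS Sa _.
by apply: PS => //; apply: sub_finite_set fS; exact: subDsetl.
Qed.

Lemma bigcup_setD1K (T U : Type) (S : set T) (a : T) (F : T -> set U) :
  S a -> \bigcup_(b in S) F b = F a `|` \bigcup_(b in S `\ a) F b.
Proof.
move=> Sa; apply/seteqP; split=> [x [b Sb Fb]|x [Fa|[b [Sb _] Fb]]].
- have [ba|ba] := pselect (b = a); first by left; rewrite -ba.
  by right; exists b.
- by exists a.
- by exists b.
Qed.

Lemma compact_bigcup_finite (T : Type) (X : topologicalType) (S : set T)
    (F : T -> set X) :
  finite_set S -> (forall a, S a -> compact (F a)) ->
  compact (\bigcup_(a in S) F a).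
Proof.
move: S; apply: finite_set_ind => [_|S a _ Sa IH cF].
  by rewrite bigcup_set0; exact: compact0.
rewrite (bigcup_setD1K _ Sa); apply: compactU; first exact: cF.
by apply: IH => b [Sb _]; exact: cF.
Qed.

Lemma within_bigcup_continuous (T : Type) (X Y : topologicalType) (S : set T)
    (F : T -> set X) (f : X -> Y) :
  hausdorff_space X -> finite_set S -> (forall a, S a -> compact (F a)) ->
  (forall a, S a -> {within F a, continuous f}) ->
  {within \bigcup_(a in S) F a, continuous f}.
Proof.
move=> hX fS; move: S fS; apply: finite_set_ind => [_ _|S a fS Sa IH cF cf].
  by rewrite bigcup_set0; exact: continuous_subspace0.
rewrite (bigcup_setD1K _ Sa).
have cpt b : (S `\ a) b -> compact (F b) by move=> [Sb _]; exact: cF.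
apply: withinU_continuous.
- by apply: compact_closed => //; exact: cF.
- by apply: compact_closed => //; exact: compact_bigcup_finite.
- exact: cf.
- by apply: IH => // b [Sb _]; exact: cf.
Qed.

Lemma within_closed_preimage (X Y : topologicalType) (A : set X) (f : X -> Y)
    (B : set Y) :
  closed A -> {within A, continuous f} -> closed B -> closed (A `&` f @^-1` B).
Proof.
move=> cA /continuous_closedP cf /cf/closed_subspaceP[V cV VB].
by rewrite setIC -VB; exact: closedI.
Qed.

Lemma within_image_closure (X Y : topologicalType) (A : set X) (f : X -> Y) :
  {within closure A, continuous f} -> f @` closure A `<=` closure (f @` A).
Proof.
move=> cf _ [x clx <-] U Ufx.
have /subspace_continuousP/(_ x clx U Ufx) := cf.
rewrite nbhs_simpl /= => /clx[y [Ay Uy]].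
by exists (f y); split; [exact: imageP|apply: Uy; exact: subset_closure].
Qed.

(** The filter [G] is generated by the tails of sets between [F] and [D], for finite [F]; along it,
    near-covering compactness becomes the finite subcover property over an arbitrary index type. *)
Lemma compact_finite_cover (X : topologicalType) (K : set X) (T : Type)
    (D : set T) (U : T -> set X) :
  compact K -> (forall i, D i -> open (U i)) -> K `<=` \bigcup_(i in D) U i ->
  exists F : set T, [/\ finite_set F, F `<=` D & K `<=` \bigcup_(i in F) U i].
Proof.
move=> /compact_near_coveringP cK oU KU.
pose G := filter_from [set F : set T | finite_set F /\ F `<=` D]
  (fun F => [set F' | F `<=` F' /\ F' `<=` D]).
have FG : Filter G.
  apply: filter_from_filter; first by exists set0; split.
  move=> A B [fA AD] [fB BD]; exists (A `|` B).
    by split; [rewrite finite_setU|rewrite subUset].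
  by move=> F [ABF FD]; split; split=> // x ?; apply: ABF; [left|right].
have [x Kx|F [fF FD] FK] := cK _ G (fun F x => (\bigcup_(i in F) U i) x) FG.
  have [i Di Ux] := KU _ Kx.
  exists (U i, [set F' | [set i] `<=` F' /\ F' `<=` D]).
    split; first exact: open_near (oU _ Di) Ux.
    exists [set i]; last by [].
    by split; [exact: finite_set1|move=> _ ->].
  by move=> [y F] /= [Uy [iF _]]; exists i => //; exact: iF.
by exists F; split=> //; apply: FK; split.
Qed.

Lemma finite_closed (X : topologicalType) (S : set X) :
  hausdorff_space X -> finite_set S -> closed S.
Proof. by move=> /hausdorff_accessible/accessible_finite_set_closed; apply. Qed.

Section CW.
Variables (L : topologicalType) (C : CW_structure L).
Let hL : hausdorff_space L := cw_hausdorff L C.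
Implicit Types (a b : cw_cell C) (S : set (cw_cell C)).

Definition closed_cell a : set L := cw_char a @` cdisk (cw_dim a).

Lemma odisk_cdisk n : odisk n `<=` cdisk n.
Proof. by move=> d; rewrite odiskE cdiskE; exact: ltW. Qed.

Lemma open_cell_sub a : cw_ocell a `<=` closed_cell a.
Proof. exact/image_subset/odisk_cdisk. Qed.

Lemma closed_cell_compact a : compact (closed_cell a).
Proof.
by apply: continuous_compact; [exact: cw_char_cont|exact: cdisk_compact].
Qed.

Lemma closed_cell_faces a : exists F : set (cw_cell C), [/\ finite_set F,
  forall b, F b -> (cw_dim b < cw_dim a)%N,
  forall d, `|d| = 1 -> cw_carrier F (cw_char a d) &
  closed_cell a `<=` cw_carrier (a |` F)].
Proof.
have [F [fF [dF bF]]] := cw_closure_finite L C a.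
have bd d : `|d| = 1 -> cw_carrier F (cw_char a d).
  move=> d1; apply: bF; exists d => //; rewrite /setD /mkset odiskE cdiskE d1.
  by split=> //; rewrite ltxx.
exists F; split=> // _ [d + <-]; rewrite cdiskE le_eqVlt => /orP[/eqP/bd|d1].
  by move=> [b Fb ?]; exists b => //; right.
by exists a; [left|exists d => //; rewrite odiskE].
Qed.

(** The combinatorial form of a subcomplex. For finite [S] it amounts to the carrier being closed,
    and it is visibly stable under unions. *)
Definition full S := forall a, S a -> closed_cell a `<=` cw_carrier S.

Lemma full_carrierE S : full S -> cw_carrier S = \bigcup_(a in S) closed_cell a.
Proof.
move=> fS; apply/seteqP; split=> [x [a Sa /open_cell_sub]|x [a Sa /(fS _ Sa)//]].
by exists a.
Qed.

Lemma full_compact S : finite_set S -> full S -> compact (cw_carrier S).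
Proof.
move=> finS /full_carrierE ->; apply: compact_bigcup_finite => // a _.
exact: closed_cell_compact.
Qed.

Lemma full_finite_subcomplex S : finite_set S -> full S -> finite_subcomplex S.
Proof. by move=> finS fS; split=> //; apply: compact_closed => //; exact: full_compact. Qed.

(** The closed disk is by definition the closure of the open one, so a closed cell lies in the
    closure of its open cell and hence in the closed carrier. *)
Lemma finite_subcomplex_full S : finite_subcomplex S -> full S.
Proof.
move=> [finS clS] a Sa x ax; apply: clS.
have : closure (cw_ocell a) x.
  by apply: within_image_closure ax; exact: cw_char_cont.
by apply: closureS => y ay; exists a.
Qed.

Lemma finite_subcomplex_compact S :
  finite_subcomplex S -> compact (cw_carrier S).
Proof. by move=> fS; apply: full_compact (finite_subcomplex_full fS); case: fS. Qed.

Lemma open_cell_unique a b x : cw_ocell a x -> cw_ocell b x -> a = b.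
Proof. exact: (cw_disjoint L C). Qed.

Lemma full_bigcup (T : Type) (D : set T) (S : T -> set (cw_cell C)) :
  (forall i, D i -> full (S i)) -> full (\bigcup_(i in D) S i).
Proof.
move=> fS a [i Di Sa] x /(fS i Di a Sa)[b Sb bx].
by exists b => //; exists i.
Qed.

(** Induction on dimension: to [a] are added the families already found for its finitely many
    faces. *)
Lemma cell_in_full a : exists S, [/\ finite_set S, full S, S a &
  forall b, S b -> (cw_dim b <= cw_dim a)%N].
Proof.
move: {2}(cw_dim a).+1 (ltnSn (cw_dim a)) => n; elim: n a => // n IH a an.
have [F [fF dF bF aF]] := closed_cell_faces a.
have /choice[S SP] b : exists S : set (cw_cell C), F b ->
    [/\ finite_set S, full S, S b & forall c, S c -> (cw_dim c <= cw_dim b)%N].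
  have [Fb|nFb] := pselect (F b); last by exists set0.
  have [|S ?] := IH b; last by exists S.
  exact: leq_trans (dF _ Fb) an.
have ful : full (\bigcup_(b in F) S b) by apply: full_bigcup => b /SP[].
exists (a |` \bigcup_(b in F) S b); split.
- rewrite finite_setU; split; first exact: finite_set1.
  by apply: bigcup_finite => // b /SP[].
- move=> b [->|Sb] x.
    move=> /aF[c [ca|Fc] cx]; exists c => //; first by left.
    by right; exists c => //; have [] := SP _ Fc.
  by move=> /(ful b Sb)[c Sc cx]; exists c => //; right.
- by left.
- move=> b [->//|[c Fc Scb]]; have [_ _ _ /(_ _ Scb)] := SP _ Fc.
  by move=> /leq_trans; apply; exact/ltnW/dF.
Qed.

Lemma exists_cell x : exists a, cw_ocell a x.
Proof. exact: (cw_cover L C). Qed.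

(* A set with at most one point in each open cell is closed by the weak
   topology, so it is discrete and meets a compact set in finitely many points. *)
Lemma compact_finite_cells (K : set L) :
  compact K -> finite_set [set a : cw_cell C | (cw_ocell a `&` K) !=set0].
Proof.
move=> cK; pose M := [set a : cw_cell C | (cw_ocell a `&` K) !=set0].
have [cell cellP] : {cell : L -> cw_cell C & forall x, cw_ocell (cell x) x}.
  exact: (choice exists_cell).
have [M0|/set0P[a0 Ma0]] := eqVneq M set0; first by rewrite -/M M0.
have /choice[pt ptP] a : exists x, M a -> cw_ocell a x /\ K x.
  have [[x ?]|nMa] := pselect (M a); first by exists x.
  by have [x _] := Ma0; exists x.
have ptclosed S : S `<=` M -> closed (pt @` S).
  move=> SM; apply: (@cw_weak _ C) => a.
  have [F [fF _ _ aF]] := closed_cell_faces a.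
  have -> : cdisk (cw_dim a) `&` cw_char a @^-1` (pt @` S) =
      cdisk (cw_dim a) `&` cw_char a @^-1` (pt @` S `&` pt @` (a |` F)).
    apply/seteqP; split=> [d [ad [b Sb bd]]|d [ad [? _]]//]; split=> //.
    split; first by exists b.
    exists b => //.
    have [c Fc cx] := aF _ (imageP (cw_char a) ad).
    have [bb _] := ptP _ (SM _ Sb); rewrite bd in bb.
    by rewrite (open_cell_unique bb cx).
  apply: within_closed_preimage; [exact: closed_ball_closed|exact: cw_char_cont|].
  apply: finite_closed => //; apply: sub_finite_set (@subIsetr _ _ _) _.
  by apply: finite_image; rewrite finite_setU; split=> //; exact: finite_set1.
(* The member of index [a] contains no chosen point other than [pt a], so a finite subcover must be
   indexed by all of [M]. *)
have [||F [fF _ KF]] := @compact_finite_cover _ K _ M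
  (fun a => ~` (pt @` (M `\ a))) cK.
- by move=> a Ma; apply/closed_openC/ptclosed => b [].
- move=> x Kx; have [[a Ma ax]|nx] := pselect ((pt @` M) x); last first.
    by exists a0 => // -[b [Mb _] bx]; apply: nx; exists b.
  exists a => // -[b [Mb nba] bx]; apply: nba.
  have [ab _] := ptP _ Ma; have [bb _] := ptP _ Mb.
  by rewrite bx -ax in bb; exact: open_cell_unique bb ab.
apply: sub_finite_set fF => a Ma.
have [_ Kp] := ptP _ Ma; have [b Fb nb] := KF _ Kp.
have [->//|nab] := pselect (a = b).
by exfalso; apply: nb; exists a.
Qed.

Lemma compact_in_finite_subcomplex (K : set L) :
  compact K -> exists S, finite_subcomplex S /\ K `<=` cw_carrier S.
Proof.
move=> /compact_finite_cells fM; set M := [set a | _] in fM.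
have /choice[S SP] a : exists S, [/\ finite_set S, full S & S a].
  by have [S [? ? ? _]] := cell_in_full a; exists S.
exists (\bigcup_(a in M) S a); split.
  apply: full_finite_subcomplex; last by apply: full_bigcup => a _; have [] := SP a.
  by apply: bigcup_finite => // a _; have [] := SP a.
move=> x Kx; have [a ax] := exists_cell x.
by exists a => //; exists a; [exists x|have [] := SP a].
Qed.

End CW.

(** * Normality of CW complexes *)

Section CWnormal.
Variables (L : topologicalType) (C : CW_structure L).
Let hL : hausdorff_space L := cw_hausdorff L C.
Implicit Types (a b : cw_cell C) (S : set (cw_cell C)).

Lemma closed_cell_lower a : exists S, [/\ finite_set S, full S,
  forall b, S b -> (cw_dim b < cw_dim a)%N &
  forall d, `|d| = 1 -> cw_carrier S (cw_char a d)].
Proof.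
have [F [fF dF bF _]] := closed_cell_faces a.
have /choice[S SP] b : exists S : set (cw_cell C),
    [/\ finite_set S, full S, S b & forall c, S c -> (cw_dim c <= cw_dim b)%N].
  exact: cell_in_full.
exists (\bigcup_(b in F) S b); split.
- by apply: bigcup_finite => // b _; have [] := SP b.
- by apply: full_bigcup => b _; have [] := SP b.
- move=> c [b Fb Sc]; have [_ _ _ /(_ _ Sc)] := SP b.
  by move=> /leq_ltn_trans; apply; exact: dF.
- move=> d /bF[b Fb bd]; exists b => //; exists b => //.
  by have [] := SP b.
Qed.

Lemma cw_continuous (T : topologicalType) (f : L -> T) :
  (forall a, {within cdisk (cw_dim a), continuous (f \o cw_char a)}) -> continuous f.
Proof.
move=> cf; apply/continuous_closedP => W cW; apply: (cw_weak L C) => a.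
exact: (@within_closed_preimage _ _ _ (f \o cw_char a) W
  (@closed_ball_closed _ _ _ _) (cf a) cW).
Qed.

Variables (B0 B1 : set L).
Hypotheses (cB0 : closed B0) (cB1 : closed B1) (B01 : B0 `&` B1 = set0).

Let cell x := projT1 (cid (@exists_cell _ C x)).
Let cellP x : cw_ocell (cell x) x. Proof. exact: projT2 (cid (@exists_cell _ C x)). Qed.
Let cellE a d : `|d| < 1 -> cell (cw_char a d) = a.
Proof.
move=> d1; apply: open_cell_unique (cellP _) _.
by exists d => //; rewrite odiskE.
Qed.
Let coord x : 'rV[RR]_(cw_dim (cell x)) := projT1 (cid2 (cellP x)).
Let coordP x : `|coord x| < 1 /\ cw_char (cell x) (coord x) = x.
Proof.
by rewrite /coord; case: cid2 => d dd dx /=; rewrite odiskE in dd.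
Qed.

(** A Urysohn function on the cells of dimension below [k], carried by a total function whose values
    on higher cells are arbitrary. *)
Let goodfun k (f : L -> RR) :=
  (forall a, (cw_dim a < k)%N ->
    {within cdisk (cw_dim a), continuous (f \o cw_char a)}) /\
  (forall x, (cw_dim (cell x) < k)%N -> (B0 x -> f x = 0) /\ (B1 x -> f x = 1)).

(** On a [k]-cell the values are prescribed on the sphere, by [f], and on the preimages of [B0] and
    [B1]. The sphere is sent to lower cells, where [f] already separates [B0] from [B1]; so the
    prescriptions agree and Tietze extends them. *)
Let extension (k : nat) (f : L -> RR) : goodfun k f ->
  forall a, (cw_dim a = k) ->
  exists2 g : 'rV[RR]_(cw_dim a) -> RR, continuous g & 
    forall d, `|d| <= 1 ->
      [/\ `|d| = 1 -> g d = f (cw_char a d),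
          `|d| < 1 -> B0 (cw_char a d) -> g d = 0 &
          `|d| < 1 -> B1 (cw_char a d) -> g d = 1].
Proof.
move=> [cf fB] a ak.
have [S [fS fuS dS bS]] := closed_cell_lower a.
have cfS : {within cw_carrier S, continuous f}.
  rewrite full_carrierE//; apply: within_bigcup_continuous => //.
    by move=> b _; exact: closed_cell_compact.
  move=> b Sb; apply: within_image_continuous => //.
  - exact: cdisk_compact.
  - exact: closed_ball_closed.
  - exact: cw_char_cont.
  - by apply: cf; rewrite -ak; exact: dS.
have cchi := cw_char_cont L C a.
have clD : closed (cdisk (cw_dim a)) by exact: closed_ball_closed.
have csph : closed [set d : 'rV[RR]_(cw_dim a) | `|d| = 1].
  apply: (closed_preimage (f := fun d : 'rV[RR]_(cw_dim a) => `|d|) (B := [set 1])).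
    by move=> d; exact: norm_continuous.
  exact/accessible_closed_set1/hausdorff_accessible/Rhausdorff.
pose Sph := [set d : 'rV[RR]_(cw_dim a) | `|d| = 1].
pose Z0 := cdisk (cw_dim a) `&` cw_char a @^-1` B0.
pose Z1 := cdisk (cw_dim a) `&` cw_char a @^-1` B1.
have cZ0 : closed Z0 by exact: within_closed_preimage.
have cZ1 : closed Z1 by exact: within_closed_preimage.
pose u d := if `|d| == 1 then f (cw_char a d) else if pselect (B0 (cw_char a d)) then 0 else 1.
have SphD : Sph `<=` cdisk (cw_dim a) by move=> d d1; rewrite cdiskE d1.
have fbd d : `|d| = 1 -> (B0 (cw_char a d) -> f (cw_char a d) = 0) /\
    (B1 (cw_char a d) -> f (cw_char a d) = 1).
  move=> /bS[b Sb [e + ed]]; rewrite odiskE => e1.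
  by apply: fB; rewrite -ed cellE// -ak; exact: dS.
have usph d : Sph d -> u d = f (cw_char a d).
  by move=> d1; rewrite /u; case: eqVneq => // /eqP[].
have uB0 d : Z0 d -> u d = 0.
  move=> [dD Bd]; rewrite /u; case: eqVneq => [/fbd[+ _]|_]; first exact.
  by case: pselect.
have uB1 d : Z1 d -> u d = 1.
  move=> [dD Bd]; rewrite /u; case: eqVneq => [/fbd[_ +]|_]; first exact.
  case: pselect => // B0d; have : (B0 `&` B1) (cw_char a d) by split.
  by rewrite B01.
have cu : {within Sph `|` Z0 `|` Z1, continuous u}.
  apply: withinU_continuous; [exact: closedU|by []| |].
    apply: withinU_continuous => //.
      apply: (@subspace_eq_continuous _ _ _ (f \o cw_char a)).
        by move=> d; rewrite inE => /usph/esym.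
      apply/within_set_val.
      pose q (z : set_type Sph) := to_set (bS _ (set_val_mem z)).
      have cq : continuous q.
        apply: continuous_to_set_type.
        have := continuous_subspaceW SphD cchi.
        by move/within_set_val.
      have /within_set_val cfS' := cfS.
      move=> z; apply: (@continuous_comp_at _ _ _ q (fun p => f (set_val p))).
        exact: cq.
      exact: cfS'.
    exact: within_constant uB0.
  exact: within_constant uB1.
have cZ : closed (Sph `|` Z0 `|` Z1) by do 2 apply: closedU => //.
have ZD : Sph `|` Z0 `|` Z1 `<=` cdisk (cw_dim a).
  by rewrite !subUset; split; [split|] => // d [].
have cptZ : compact (Sph `|` Z0 `|` Z1) := subclosed_compact cZ (@cdisk_compact _) ZD.
have [g cg gu] := tietze (@pseudometric_normal RR _) cZ cptZ cu.
exists g => // d d1; have dD : cdisk (cw_dim a) d by rewrite cdiskE.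
split=> [e1|e1 Bd|e1 Bd].
- by rewrite gu; [rewrite /u e1 eqxx|left; left].
- by rewrite gu; [exact: uB0|left; right].
- by rewrite gu; [exact: uB1|right].
Qed.

Let step (k : nat) (f : L -> RR) : goodfun k f -> exists f', goodfun k.+1 f' /\
  forall x, (cw_dim (cell x) < k)%N -> f' x = f x.
Proof.
move=> gf.
have gex a : exists g : 'rV[RR]_(cw_dim a) -> RR, cw_dim a = k ->
    continuous g /\ forall d, `|d| <= 1 ->
      [/\ `|d| = 1 -> g d = f (cw_char a d),
          `|d| < 1 -> B0 (cw_char a d) -> g d = 0 &
          `|d| < 1 -> B1 (cw_char a d) -> g d = 1].
  have [ak|nak] := pselect (cw_dim a = k); last by exists (fun=> 0).
  by have [g cg gP] := extension gf ak; exists g.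
pose g a := projT1 (cid (gex a)); have gP a := projT2 (cid (gex a)).
pose f' x := if cw_dim (cell x) == k then g (cell x) (coord x) else f x.
have ff' x : (cw_dim (cell x) < k)%N -> f' x = f x.
  by rewrite /f' => /ltn_eqF ->.
have fE a d : cw_dim a = k -> `|d| < 1 -> f' (cw_char a d) = g a d.
  move=> ak d1; rewrite /f'.
  have [co1 coE] := coordP (cw_char a d).
  rewrite (_ : cw_dim (cell (cw_char a d)) == k); last by rewrite cellE// ak.
  move: (coord _) co1 coE; rewrite cellE// => e e1 ed.
  by congr g; apply: (cw_inj L C a) => //; rewrite inE odiskE.
exists f'; split=> //; split=> [a|x].
  rewrite ltnS leq_eqVlt => /orP[/eqP ak|ak].
    have [cg gd] := gP a ak.
    apply: (@subspace_eq_continuous _ _ _ (g a)); last exact: continuous_subspaceT.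
    move=> d; rewrite inE cdiskE => /[dup] d1; rewrite le_eqVlt => /orP[/eqP e1|e1] /=;
      last exact/esym/fE.
    suff : g a d = f' (cw_char a d) by [].
    have [S [_ _ dS /(_ d e1)[b Sb [e + ed]]]] := closed_cell_lower a.
    rewrite odiskE => e1'; rewrite ff'; last by rewrite -ed cellE// -ak dS.
    by have [/(_ e1)] := gd d d1.
  apply: (@subspace_eq_continuous _ _ _ (f \o cw_char a)); last exact: (gf.1 a ak).
  move=> d; rewrite inE => dD; suff : f (cw_char a d) = f' (cw_char a d) by [].
  rewrite ff'//.
  have [S [_ _ Sa dS]] := cell_in_full a.
  have [F [_ dF _ aF]] := closed_cell_faces a.
  have [b Fb [e + ed]] := aF _ (imageP (cw_char a) dD).
  rewrite odiskE => e1; rewrite -ed cellE//.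
  by case: Fb => [->//|/dF/ltn_trans]; apply.
rewrite ltnS leq_eqVlt => /orP[/eqP xk|xk]; last by rewrite ff'//; exact: (gf.2 x xk).
have [co1 coE] := coordP x.
have [_ /(_ _ (ltW co1))[_ g0 g1]] := gP _ xk.
by rewrite /f' xk eqxx; split=> Bx; [apply: g0|apply: g1]; rewrite ?coE.
Qed.

Lemma cw_urysohn : exists f : L -> RR, [/\ continuous f,
  forall x, B0 x -> f x = 0 & forall x, B1 x -> f x = 1].
Proof.
have nextP k f : exists f', goodfun k f -> goodfun k.+1 f' /\
    forall x, (cw_dim (cell x) < k)%N -> f' x = f x.
  have [gf|ngf] := pselect (goodfun k f); last by exists f.
  by have [f' ?] := step gf; exists f'.
pose next k f := projT1 (cid (nextP k f)).
pose F := fix F k := if k is j.+1 then next j (F j) else (fun=> 0) : L -> RR.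
have gF k : goodfun k (F k).
  elim: k => [|k IH]; first by split.
  by have [] := projT2 (cid (nextP k (F k))) IH.
have FS k x : (cw_dim (cell x) < k)%N -> F k.+1 x = F k x.
  by move=> xk; have [_] := projT2 (cid (nextP k (F k))) (gF k); apply.
have FE k x : (cw_dim (cell x) < k)%N -> F k x = F (cw_dim (cell x)).+1 x.
  elim: k => // k IH; rewrite ltnS leq_eqVlt => /orP[/eqP <-//|xk].
  by rewrite FS// IH.
(* At [x] the stages are constant from [cw_dim (cell x) + 1] on, so [f] is their limit. On each
   closed cell it equals a single stage, and the weak topology yields continuity. *)
pose f x := F (cw_dim (cell x)).+1 x.
exists f; split.
- apply: cw_continuous => a.
  apply: (@subspace_eq_continuous _ _ _ (F (cw_dim a).+1 \o cw_char a));
    last exact: ((gF _).1 a (ltnSn _)).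
  move=> d; rewrite inE => dD.
  suff : F (cw_dim a).+1 (cw_char a d) = f (cw_char a d) by [].
  have [G [_ dG _ aG]] := closed_cell_faces a.
  have [b Gb [e + ed]] := aG _ (imageP (cw_char a) dD).
  rewrite odiskE => e1; rewrite /f FE// -ed cellE//.
  by case: Gb => [->//|/dG/ltnW]; rewrite -ltnS.
- by move=> x Bx; exact: ((gF _).2 x (ltnSn _)).1.
- by move=> x Bx; exact: ((gF _).2 x (ltnSn _)).2.
Qed.

End CWnormal.

Lemma cw_normal (L : topologicalType) (C : CW_structure L) : normal_space L.
Proof.
apply/(@normal_openP RR) => A B cA cB AB0.
have [f [cf f0 f1]] := cw_urysohn C cA cB AB0.
exists [set x | f x < 1/2], [set x | 1/2 < f x]; split.
- exact: continuous_gt.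
- exact: continuous_lt.
- by move=> x /f0 /= ->; lra.
- by move=> x /f1 /= ->; lra.
- by apply/seteqP; split=> // x [/=] /lt_trans /[apply]; rewrite ltxx.
Qed.

Lemma cw_tychonoff (L : topologicalType) (C : CW_structure L) : tychonoff_sp L.
Proof. exact: normal_tychonoff (cw_hausdorff L C) (cw_normal C). Qed.

Lemma continuous_rV (X : topologicalType) n (f : X -> 'rV[RR]_n) (x : X) :
  (forall i, {for x, continuous (fun z => f z 0 i)}) -> {for x, continuous f}.
Proof.
move=> cf; rewrite /prop_for /continuous_at; apply/cvg_ballP => e e0.
have : \forall z \near x, forall i, ball (f x 0 i) e (f z 0 i).
  by apply: filter_forall => i; move/cvg_ballP: (cf i); apply.
apply: filterS => z bz; split=> // i j.
by rewrite (ord1 i); exact: bz.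
Qed.

Lemma continuous_coord_at (X : topologicalType) n (f : X -> 'rV[RR]_n) (x : X) i :
  {for x, continuous f} -> {for x, continuous (fun z => f z 0 i)}.
Proof.
move=> cf; apply: (@continuous_comp_at _ _ _ f (fun v : 'rV[RR]_n => v 0 i)) => //.
exact: coord_continuous.
Qed.

(** * Finite subcomplexes as Euclidean neighbourhood retracts *)

Section CWretract.
Variables (L : topologicalType) (C : CW_structure L) (l0 : L).
Let hL : hausdorff_space L := cw_hausdorff L C.

(** A top cell [a] is attached to the carrier of the remaining cells along its sphere, so the
    retraction is built one cell at a time. *)
Lemma full_retract (S : set (cw_cell C)) :
  finite_set S -> full S -> euclidean_retract (cw_carrier S).
Proof.
move: S; apply: (finite_set_ind_dim (dim := @cw_dim L C)) => [_|S a fS Sa amax IH fuS].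
  exists 0%N, (fun=> 0), set0, (fun=> l0); split=> //.
  - by move=> x; exact: continuous_cst_at.
  - by move=> p [].
have ocell_in b x : S b -> cw_ocell b x -> (cw_dim b < cw_dim a)%N -> cw_carrier (S `\ a) x.
  by move=> Sb bx ba; exists b => //; split=> // eba; rewrite eba ltnn in ba.
have fuS' : full (S `\ a).
  move=> b [Sb nba] x bx.
  have [F [_ dF _ /(_ x bx)[c Fc cx]]] := closed_cell_faces b.
  case: Fc => [cb|/dF cb]; first by exists b; [|rewrite -cb].
  have [c' Sc' c'x] := fuS b Sb x bx.
  have ec := open_cell_unique cx c'x; subst c'.
  by apply: ocell_in cx _ => //; exact: leq_trans cb (amax _ Sb).
have fS' : finite_set (S `\ a) by apply: sub_finite_set fS; exact: subDsetl.
have [m [phi [N [r [cphi oN Nr phiN]]]]] := IH fuS'.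
have bd d : `|d| = 1 -> cw_carrier (S `\ a) (cw_char a d).
  move=> d1; have [F [_ dF bF _]] := closed_cell_faces a.
  have [c Fc cx] := bF d d1.
  have [|c' Sc' c'x] := fuS a Sa (cw_char a d).
    by exists d => //; rewrite cdiskE d1.
  have ec := open_cell_unique cx c'x; subst c'.
  by apply: ocell_in cx _ => //; exact: dF.
have int d : `|d| < 1 -> ~ cw_carrier (S `\ a) (cw_char a d).
  move=> d1 [b [_ nba] bx]; apply: nba; apply: open_cell_unique bx _.
  by exists d => //; rewrite odiskE.
have inj d e : `|d| < 1 -> `|e| < 1 -> cw_char a d = cw_char a e -> d = e.
  by move=> d1 e1; apply: (cw_inj L C a); rewrite inE odiskE.
have SE : cw_carrier S = cw_carrier (S `\ a) `|` cw_char a @` cdisk (cw_dim a).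
  by rewrite full_carrierE// (bigcup_setD1K _ Sa) setUC full_carrierE.
have [Phi [N' [R [cPhi oN' NR PhiN]]]] := cell_attachment_retract hL
  (full_compact fS' fuS') (cw_char_cont L C a) bd int inj cphi oN
  (fun y Ny => (Nr y Ny).1) (fun y Ny => (Nr y Ny).2)
  (fun p Pp => (phiN p Pp).1) (fun p Pp => (phiN p Pp).2).
rewrite SE; set n := cw_dim a in Phi N' R cPhi oN' NR PhiN *.
pose E := ('rV[RR]_m * RR * 'rV[RR]_n)%type.
(* Attaching a cell yields a product of normed spaces; [conv] and [back] identify it with row
   vectors so that the induction can continue. *)
pose conv (v : E) : 'rV[RR]_(m + (1 + n)) := row_mx v.1.1 (row_mx (v.1.2)%:M v.2).
pose back (u : 'rV[RR]_(m + (1 + n))) : E :=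
  (lsubmx u, (lsubmx (rsubmx u)) 0 0, rsubmx (rsubmx u)).
have convK v : back (conv v) = v.
  by rewrite /back /conv !row_mxKr !row_mxKl mxE eqxx mulr1n; case: v => [[]].
have c11 : continuous (fun v : E => v.1.1).
  by move=> v; apply: (@continuous_comp_at E _ _ fst fst); exact: cvg_fst.
have c12 : continuous (fun v : E => v.1.2).
  by move=> v; apply: (@continuous_comp_at E _ _ fst snd); [exact: cvg_fst|exact: cvg_snd].
have cconv : continuous conv.
  move=> v; apply: continuous_rV => i; rewrite /conv.
  case: (split_ordP i) => j ->.
    apply: (@continuous_ext_at _ _ (fun v : E => v.1.1 0 j)).
      by apply: continuous_coord_at; exact: c11.
    by move=> w; rewrite row_mxEl.
  case: (split_ordP j) => k ->.
    apply: (@continuous_ext_at _ _ (fun v : E => v.1.2)); first exact: c12.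
    by move=> w; rewrite row_mxEr row_mxEl (ord1 k) mxE eqxx mulr1n.
  apply: (@continuous_ext_at _ _ (fun v : E => v.2 0 k)).
    by apply: (@continuous_coord_at E _ snd); exact: cvg_snd.
  by move=> w; rewrite !row_mxEr.
have cback : continuous back.
  move=> u.
  have sub_c k (h : 'I_k -> 'I_(m + (1 + n))) :
      {for u, continuous (fun u : 'rV[RR]_(m + (1 + n)) => \row_j u 0 (h j))}.
    apply: continuous_rV => i.
    apply: (@continuous_ext_at _ _ (fun u : 'rV[RR]_(m + (1 + n)) => u 0 (h i))).
      exact: coord_continuous.
    by move=> w; rewrite mxE.
  apply: (@continuous_pair_at _ ('rV[RR]_m * RR)%type _
    (fun u => (lsubmx u, (lsubmx (rsubmx u)) 0 0)) (fun u => rsubmx (rsubmx u))).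
    apply: (@continuous_pair_at _ _ RR lsubmx (fun u => (lsubmx (rsubmx u)) 0 0)).
      apply: (continuous_ext_at (sub_c _ (lshift _))).
      by move=> w; apply/rowP => j; rewrite !mxE.
    apply: (@continuous_ext_at _ _ (fun u : 'rV[RR]_(m + (1 + n)) => u 0 (rshift m (lshift n 0)))).
      exact: coord_continuous.
    by move=> w; rewrite !mxE.
  apply: (continuous_ext_at (sub_c _ (fun j => rshift m (rshift 1 j)))).
  by move=> w; apply/rowP => j; rewrite !mxE.
exists (m + (1 + n))%N, (conv \o Phi), (back @^-1` N'), (R \o back); split.
- move=> p; apply: (@continuous_comp_at (subspace _) _ _ Phi conv); last exact: cconv.
  exact: cPhi.
- exact: open_preimage.
- move=> v Nv; have [cR PR] := NR _ Nv; split=> //.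
  by apply: (@continuous_comp_at _ _ _ back R) => //; exact: cback.
- by move=> p Pp; rewrite /= convK; exact: PhiN.
Qed.

Lemma finite_subcomplex_retract (S : set (cw_cell C)) :
  finite_subcomplex S -> euclidean_retract (cw_carrier S).
Proof. by move=> fS; apply: full_retract (finite_subcomplex_full fS); case: fS. Qed.

End CWretract.

(** * Infinite cardinals *)

(** Comparability of cardinals: by Zorn there is a maximal graph of a partial injection between [A]
    and [B], and it must exhaust one of them. *)
Lemma partial_injection_total (T : Type) (A B : set T) :
  (exists2 f : T -> T, (forall x, A x -> B (f x)) &
     forall x y, A x -> A y -> f x = f y -> x = y) \/
  (exists2 f : T -> T, (forall x, B x -> A (f x)) &
     forall x y, B x -> B y -> f x = f y -> x = y).
Proof.
pose Q (R : set (T * T)) := [/\ forall u, R u -> A u.1 /\ B u.2,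
  (forall u v, R u -> R v -> u.1 = v.1 -> u = v) &
  (forall u v, R u -> R v -> u.2 = v.2 -> u = v)].
have [F FQ tF|R [[RAB Rfun Rinj] Rmax]] := @Zorn_bigcup _ Q.
  have two u v : (\bigcup_(X in F) X) u -> (\bigcup_(X in F) X) v ->
      exists X, [/\ F X, X u & X v].
    move=> [X FX Xu] [Y FY Yv]; have [XY|YX] := tF _ _ FX FY.
      by exists Y; split=> //; exact: XY.
    by exists X; split=> //; exact: YX.
  split.
  - by move=> u [X FX Xu]; have [/(_ u Xu)] := FQ X FX.
  - by move=> u v Fu Fv; have [X [FX Xu Xv]] := two u v Fu Fv;
      have [_ /(_ _ _ Xu Xv)] := FQ X FX.
  - by move=> u v Fu Fv; have [X [FX Xu Xv]] := two u v Fu Fv;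
      have [_ _ /(_ _ _ Xu Xv)] := FQ X FX.
have [dA|] := pselect (forall a, A a -> exists b, R (a, b)).
  left; have /choice[f fP] a : exists b, A a -> R (a, b).
    by have [/dA[b ?]|?] := pselect (A a); [exists b|exists a].
  exists f; first by move=> x /fP/RAB[].
  by move=> x y /fP Rx /fP Ry fxy; have [] := Rinj _ _ Rx Ry fxy.
move=> /existsNP[a0 /not_implyP[Aa0 na0]].
have [dB|] := pselect (forall b, B b -> exists a, R (a, b)).
  right; have /choice[f fP] b : exists a, B b -> R (a, b).
    by have [/dB[a ?]|?] := pselect (B b); [exists a|exists b].
  exists f; first by move=> x /fP/RAB[].
  by move=> x y /fP Rx /fP Ry fxy; have [] := Rfun _ _ Rx Ry fxy.
move=> /existsNP[b0 /not_implyP[Bb0 nb0]].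
exfalso; apply: (Rmax (R `|` [set (a0, b0)])).
  split; first by move=> u; left.
  by move=> /(_ (a0, b0)) Rab; apply: na0; exists b0; apply: Rab; right.
split.
- by move=> u [/RAB//|->].
- move=> [u1 u2] [v1 v2] [Ru|[-> ->]] [Rv|[-> ->]] //=.
  + exact: (Rfun _ _ Ru Rv).
  + by move=> u1a; rewrite u1a in Ru; exfalso; apply: na0; exists u2.
  + by move=> v1a; rewrite -v1a in Rv; exfalso; apply: na0; exists v2.
- move=> [u1 u2] [v1 v2] [Ru|[-> ->]] [Rv|[-> ->]] //=.
  + exact: (Rinj _ _ Ru Rv).
  + by move=> u2b; rewrite u2b in Ru; exfalso; apply: nb0; exists u1.
  + by move=> v2b; rewrite -v2b in Rv; exfalso; apply: nb0; exists v1.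
Qed.

Section InfiniteCardinal.
Variables (I : Type) (I_inf : infinite_set [set: I]).

Lemma infinite_injection_nat : exists f : nat -> I, injective f.
Proof.
have /infiniteP/card_leP[f] := I_inf.
exists (fun n => set_val (f (to_set (Logic.I : [set: nat] n)))) => x y.
by move=> /set_val_injective /(@inj _ _ _ f) /=; rewrite !inE => /(_ Logic.I Logic.I)[].
Qed.

(* The graph [G] of an injection [A * A -> A]; [A] is recovered as the set of
   points of the diagonal. *)
Let dom (G : set (I * I * I)) : set I := [set x | exists z, G (x, x, z)].
Let pairing (G : set (I * I * I)) := [/\
  forall x y z, G (x, y, z) -> [/\ dom G x, dom G y & dom G z],
  forall x y, dom G x -> dom G y -> exists z, G (x, y, z),
  forall x y z z', G (x, y, z) -> G (x, y, z') -> z = z' &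
  forall x y x' y' z, G (x, y, z) -> G (x', y', z) -> x = x' /\ y = y'].

(** Zorn gives a maximal injection from [A * A] to [A]. If the complement of [A] injects into [A],
    then so does [I], and the injection is transported. Otherwise the complement contains a copy
    [A'] of [A], and the injection extends to the square of the union, against maximality. *)
Lemma infinite_injection_prod : exists f : I * I -> I, injective f.
Proof.
have [nu nu_inj] := infinite_injection_nat.
pose pr (a b : nat) : nat := pickle (a, b).
have pr_inj a b a' b' : pr a b = pr a' b' -> a = a' /\ b = b'.
  by move=> /(pcan_inj pickleK)[].
pose G0 := [set u : I * I * I | exists a b, u = (nu a, nu b, nu (pr a b))].
have domU (G G' : set (I * I * I)) : G `<=` G' -> dom G `<=` dom G'.
  by move=> GG' x [z Gz]; exists z; exact: GG'.
have dom0 a : dom G0 (nu a) by exists (nu (pr a a)), a, a.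
have pairing0 : pairing G0.
  have domE x : dom G0 x -> exists a, x = nu a.
    by move=> [z [a [b [-> _ _]]]]; exists a.
  split.
  - by move=> x y z [a [b [-> -> ->]]]; split; exact: dom0.
  - by move=> x y /domE[a ->] /domE[b ->]; exists (nu (pr a b)), a, b.
  - move=> x y z z' [a [b [-> -> ->]]] [a' [b' [/nu_inj -> /nu_inj -> ->]]] //.
  - move=> x y x' y' z [a [b [-> -> ->]]] [a' [b' [-> -> /nu_inj]]].
    by move=> /pr_inj[-> ->].
(* Joining [G0] to every graph makes the empty chain admissible and keeps the countable set
   [range nu] inside [A]. *)
have [F FQ tF|G [Gp Gmax]] := @Zorn_bigcup _ (fun G => pairing (G0 `|` G)).
  set U := \bigcup_(X in F) X.
  have [F0|/set0P[X0 FX0]] := eqVneq F set0.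
    by rewrite /U F0 bigcup_set0 setU0.
  have lift u : (G0 `|` U) u -> exists X, F X /\ (G0 `|` X) u.
    move=> [Gu|[X FX Xu]]; first by exists X0; split=> //; left.
    by exists X; split=> //; right.
  have join X Y : F X -> F Y -> exists Z, [/\ F Z, G0 `|` X `<=` G0 `|` Z &
      G0 `|` Y `<=` G0 `|` Z].
    move=> FX FY; have [XY|YX] := tF _ _ FX FY.
      by exists Y; split=> //; exact: setUS.
    by exists X; split=> //; exact: setUS.
  have two u v : (G0 `|` U) u -> (G0 `|` U) v -> exists Z, [/\ F Z,
      (G0 `|` Z) u & (G0 `|` Z) v].
    move=> /lift[X [FX Xu]] /lift[Y [FY Yv]].
    by have [Z [FZ XZ YZ]] := join X Y FX FY; exists Z; split=> //; [exact: XZ|exact: YZ].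
  have up X : F X -> G0 `|` X `<=` G0 `|` U.
    by move=> FX; apply: setUS => u Xu; exists X.
  split.
  - move=> x y z /lift[X [FX Xu]]; have [/(_ _ _ _ Xu)[dx dy dz] _ _ _] := FQ X FX.
    by split; apply: domU (up X FX) _ _.
  - move=> x y [z /[dup] Gz /lift[X [FX Xz]]] [z' /lift[Y [FY Yz]]].
    have [Z [FZ XZ YZ]] := join X Y FX FY.
    have [_ tot _ _] := FQ Z FZ.
    have [||w Zw] := tot x y; first by exists z; exact: XZ.
      by exists z'; exact: YZ.
    by exists w; exact: up Zw.
  - move=> x y z z' /two/[apply] -[Z [FZ Zz Zz']].
    by have [_ _ fn _] := FQ Z FZ; exact: fn Zz Zz'.
  - move=> x y x' y' z /two/[apply] -[Z [FZ Zz Zz']].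
    by have [_ _ _ ij] := FQ Z FZ; exact: ij Zz Zz'.
set H := G0 `|` G in Gp; set A := dom H.
have [Hdom Htot Hfun Hinj] := Gp.
have /choice[f fP] (u : I * I) : exists z, A u.1 -> A u.2 -> H (u.1, u.2, z).
  have [[Ax Ay]|nA] := pselect (A u.1 /\ A u.2).
    by have [z ?] := Htot _ _ Ax Ay; exists z.
  by exists (nu 0%N) => Ax Ay; case: nA.
have fA x y : A x -> A y -> A (f (x, y)).
  by move=> Ax Ay; have [] := Hdom _ _ _ (fP (x, y) Ax Ay).
have f_inj x y x' y' : A x -> A y -> A x' -> A y' -> f (x, y) = f (x', y') ->
    x = x' /\ y = y'.
  move=> Ax Ay Ax' Ay' e; have h := fP (x, y) Ax Ay; have h' := fP (x', y') Ax' Ay'.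
  by move: h h'; rewrite /= e; exact: Hinj.
have Anu a : A (nu a) by apply: domU (dom0 a); exact: subsetUl.
have [[g gA g_inj]|[g gB g_inj]] := partial_injection_total (~` A) A.
  (* The tags [nu 0] and [nu 1] give two disjoint copies of [A] inside [A], one for [A] and one for
     its complement. *)
  pose h x := if pselect (A x) then f (nu 0%N, x) else f (nu 1%N, g x).
  have hA x : A (h x).
    by rewrite /h; case: pselect => [Ax|/gA gx] /=; exact: fA.
  have h_inj : injective h.
    move=> x y; rewrite /h; case: pselect => [Ax|nAx]; case: pselect => [Ay|nAy] /=.
    - by move=> /f_inj[].
    - by move=> /f_inj[]//; [exact: gA|move=> /nu_inj].
    - by move=> /f_inj[]//; [exact: gA|move=> /nu_inj].
    - by move=> /f_inj[]//; [exact: gA|exact: gA|move=> _; exact: g_inj].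
  exists (fun u => f (h u.1, h u.2)) => -[x y] [x' y'] /=.
  by move=> /f_inj[]// /h_inj -> /h_inj ->.
exfalso.
pose A' := g @` A.
have A'A x : A' x -> ~ A x by move=> [a Aa <-]; exact: gB.
(* [k] tags the three blocks of [(A `|` A') ^ 2] outside [A ^ 2]. *)
pose val (i : bool) a := if i then g a else a.
pose new := [set u : I * I * I | exists i j a b, [/\ i || j, A a, A b &
  u = (val i a, val j b, g (f (nu (i + j.*2)%N, f (a, b))))]].
have val_inj i j a b : A a -> A b -> val i a = val j b -> i = j /\ a = b.
  move=> Aa Ab; rewrite /val; case: i; case: j => //.
  - by move=> /g_inj ->.
  - by move=> e; have := gB _ Aa; rewrite e.
  - by move=> e; have := gB _ Ab; rewrite -e.
have HA x y z : H (x, y, z) -> [/\ A x, A y & A z] by exact: Hdom.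
have domN x : dom (H `|` new) x <-> A x \/ A' x.
  split.
    move=> [z [/HA[]|[i [j [a [b [ij Aa Ab [-> _ _]]]]]]]]; first by left.
    by case: i ij => ij; [right; exists a|left].
  move=> [[z Hz]|[a Aa <-]]; first by exists z; left.
  by eexists; right; exists true, true, a, a; split.
apply: (Gmax (G `|` new)).
  split; first exact: subsetUl.
  move=> sub; have /sub Gn : (G `|` new) (g (nu 0%N), g (nu 0%N),
      g (f (nu 3%N, f (nu 0%N, nu 0%N)))).
    by right; exists true, true, (nu 0%N), (nu 0%N); split.
  have [Ag _ _] := HA _ _ _ (or_intror Gn : H _).
  exact: gB (Anu 0%N) Ag.
rewrite setUA -/H; split.
- move=> x y z [/HA[Ax Ay Az]|[i [j [a [b [ij Aa Ab [-> -> ->]]]]]]].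
    by split; apply/domN; left.
  split; apply/domN.
  + by rewrite /val; case: (i); [right; exists a|left].
  + by rewrite /val; case: (j); [right; exists b|left].
  + right; exists (f (nu (i + j.*2)%N, f (a, b))) => //.
    exact: (fA _ _ (Anu _) (fA _ _ Aa Ab)).
- have valP x : A x \/ A' x -> exists i a, A a /\ x = val i a.
    by move=> [Ax|[a Aa <-]]; [exists false, x|exists true, a].
  move=> x y /domN/valP[i [a [Aa ->]]] /domN/valP[j [b [Ab ->]]].
  have [ij|nij] := boolP (i || j).
    by eexists; right; exists i, j, a, b; split.
  move: nij; rewrite negb_or => /andP[/negbTE -> /negbTE ->] /=.
  by have [z Hz] := Htot _ _ Aa Ab; exists z; left.
- have mix x y z z' : H (x, y, z) -> ~ new (x, y, z').
    move=> /HA[Ax Ay _] [i [j [a [b [ij Aa Ab [xE yE _]]]]]].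
    case: i xE ij => [xE _|xE /= ij]; first by apply: (A'A x) => //; exists a.
    by rewrite ij in yE; apply: (A'A y) => //; exists b.
  move=> x y z z' [Hz|nz] [Hz'|nz'].
  + exact: Hfun Hz Hz'.
  + by case: (mix _ _ _ _ Hz nz').
  + by case: (mix _ _ _ _ Hz' nz).
  + move: nz nz' => [i [j [a [b [ij Aa Ab [-> -> ->]]]]]].
    move=> [i' [j' [a' [b' [ij' Aa' Ab' [e1 e2 ->]]]]]].
    by have [-> ->] := val_inj _ _ _ _ Aa Aa' e1; have [-> ->] := val_inj _ _ _ _ Ab Ab' e2.
- have mix x y x' y' z : H (x, y, z) -> ~ new (x', y', z).
    move=> /HA[_ _ Az] [i [j [a [b [ij Aa Ab [_ _ zE]]]]]].
    apply: (A'A z) => //; rewrite zE; exists (f (nu (i + j.*2)%N, f (a, b))) => //.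
    exact: (fA _ _ (Anu _) (fA _ _ Aa Ab)).
  move=> x y x' y' z [Hz|nz] [Hz'|nz'].
  + exact: Hinj Hz Hz'.
  + by case: (mix _ _ _ _ _ Hz nz').
  + by case: (mix _ _ _ _ _ Hz' nz).
  + move: nz nz' => [i [j [a [b [ij Aa Ab [-> -> ->]]]]]].
    move=> [i' [j' [a' [b' [ij' Aa' Ab' [-> -> e]]]]]].
    have Af := fA _ _ Aa Ab; have Af' := fA _ _ Aa' Ab'.
    have e1 := g_inj _ _ (fA _ _ (Anu _) Af) (fA _ _ (Anu _) Af') e.
    have [/nu_inj eij e2] := f_inj _ _ _ _ (Anu _) Af (Anu _) Af' e1.
    have [-> ->] := f_inj _ _ _ _ Aa Ab Aa' Ab' e2.
    by move: eij; case: i {ij e e1} => /=; case: j => /=; case: i' {ij'} => /=; case: j'.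
Qed.

Definition embeds (T : Type) := exists f : T -> I, injective f.

Lemma embeds_id : embeds I.
Proof. by exists id. Qed.

Lemma embeds_inj (T U : Type) (f : T -> U) : injective f -> embeds U -> embeds T.
Proof. by move=> fi [g gi]; exists (g \o f); exact: inj_comp. Qed.

Lemma embeds_nat : embeds nat.
Proof. exact: infinite_injection_nat. Qed.

Lemma embeds_prod (T U : Type) : embeds T -> embeds U -> embeds (T * U).
Proof.
move=> [f fi] [g gi]; have [p pI] := infinite_injection_prod.
by exists (fun u => p (f u.1, g u.2)) => -[x y] [x' y'] /= /pI[/fi -> /gi ->].
Qed.

Lemma embeds_sum (T U : Type) : embeds T -> embeds U -> embeds (T + U).
Proof.
move=> [f fi] [g gi].
apply: (@embeds_inj _ (nat * I) (fun u => match u with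
  inl x => (0%N, f x) | inr y => (1%N, g y) end)).
  by move=> [x|x] [y|y] // [] => [/fi ->|/gi ->].
exact: embeds_prod embeds_nat embeds_id.
Qed.

Lemma embeds_seq (T : Type) : embeds T -> embeds (seq T).
Proof.
move=> [f fi]; have [p pI] := infinite_injection_prod.
have [nu nuI] := embeds_nat.
pose enc := fix enc (s : seq T) := if s is x :: s' then p (f x, enc s') else nu 0%N.
exists (fun s => p (nu (size s), enc s)) => s s' /pI[/nuI ss'].
elim: s s' ss' => [[]//|x s IH [//|y s'] /= [ss'] /pI[/fi -> /(IH _ ss') ->]] //.
Qed.

Lemma embeds_tree (T : Type) : embeds T -> embeds (GenTree.tree T).
Proof.
move=> eT; apply: (embeds_inj (pcan_inj (@GenTree.codeK T))).
exact/embeds_seq/(embeds_sum embeds_nat).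
Qed.

End InfiniteCardinal.

(** * Weight and products *)

Lemma rV_countable_base n : exists b : nat -> set 'rV[RR]_n,
  (forall k, open (b k)) /\
  forall (U : set 'rV[RR]_n) x, open U -> U x -> exists k, b k x /\ b k `<=` U.
Proof.
pose c (u : 'rV[rat]_n * nat) : set 'rV[RR]_n :=
  ball (map_mx ratr u.1 : 'rV[RR]_n) (u.2.+1%:R^-1).
exists (fun k => if unpickle k is Some u then c u else set0); split.
  by move=> k; case: unpickle => [u|]; [exact: ball_open|exact: open0].
move=> U x oU Ux; have /nbhs_ballP[e /= e0 eU] := open_near oU Ux.
have [j je] : exists j : nat, j.+1%:R^-1 < e / 2 :> RR.
  have e20 : 0 < e / 2 by rewrite divr_gt0.
  exists (Num.truncn (e / 2)^-1).
  by rewrite invf_plt ?posrE// truncnS_gt.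
have j0 : 0 < j.+1%:R^-1 :> RR by rewrite invr_gt0.
have /choice[q qP] i : exists q : rat, `|x 0 i - ratr q| < j.+1%:R^-1.
  have [|q] := @rat_in_itvoo RR (x 0 i - j.+1%:R^-1) (x 0 i + j.+1%:R^-1).
    by rewrite ltrBlDr -addrA ltrDl addr_gt0.
  by rewrite in_itv /= => q12; exists q; rewrite ltr_distlC.
have bx : ball (map_mx ratr (\row_i q i) : 'rV[RR]_n) (j.+1%:R^-1) x.
  split=> // i k; rewrite (ord1 i) !mxE /ball /= distrC.
  exact: qP.
exists (pickle (\row_i q i, j)); rewrite pickleK; split=> // y yb.
apply: eU; have : ball x (j.+1%:R^-1 + j.+1%:R^-1) y.
  exact: ball_triangle (ball_sym bx) yb.
by apply: le_ball; move: je; rewrite ltr_pdivlMr// mulr_natr mulr2n => /ltW.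
Qed.

Lemma RR_countable_base : exists b : nat -> set RR,
  (forall k, open (b k)) /\
  forall (U : set RR) x, open U -> U x -> exists k, b k x /\ b k `<=` U.
Proof.
have [b [ob bP]] := rV_countable_base 1.
have cc : continuous (fun x : RR => const_mx x : 'rV[RR]_1).
  move=> x; apply: continuous_rV => i.
  by apply: (continuous_ext_at (@continuous_id_at _ x)) => z; rewrite mxE.
exists (fun k => [set x | b k (const_mx x)]); split.
  by move=> k; exact: (open_preimage cc).
move=> U x oU Ux.
have oV : open [set v : 'rV[RR]_1 | U (v 0 0)].
  by apply: (open_preimage (f := fun v : 'rV[RR]_1 => v 0 0)) => //; exact: coord_continuous.
have [|k [bx bU]] := bP _ (const_mx x) oV; first by rewrite /= mxE.
by exists k; split=> // y /bU /=; rewrite mxE.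
Qed.

(** By compactness of [K], finite unions of base sets suffice, and lists of naturals code them. *)
Lemma countable_separating_family (T : topologicalType) (b : nat -> set T) :
  (forall k, open (b k)) ->
  (forall (U : set T) x, open U -> U x -> exists k, b k x /\ b k `<=` U) ->
  exists O : nat -> set T, (forall o, open (O o)) /\
    forall K N, compact K -> open N -> K `<=` N ->
      exists o, K `<=` O o /\ O o `<=` N.
Proof.
move=> ob bP; pose ks o : seq nat := odflt [::] (unpickle o).
pose O o := \bigcup_(k in [set k | k \in ks o]) b k.
exists O; split; first by move=> o; apply: bigcup_open => k _; exact: ob.
move=> K N cK oN KN.
have [||F [fF FN KF]] := @compact_finite_cover _ K _ [set k | b k `<=` N] b cK.
- by move=> k _; exact: ob.
- by move=> x /KN Nx; have [k [bx kN]] := bP _ _ oN Nx; exists k.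
have /finite_seqP[s Fs] := fF.
exists (pickle s); rewrite /O /ks pickleK /= -Fs; split=> //.
by apply: bigcup_sub => k /FN.
Qed.

Section Weight.
Variables (I : Type) (I_inf : infinite_set [set: I]).

(** An index [i] receives the union over its preimages under [f], which is one [b k] or empty. *)
Lemma weight_le_base (X : topologicalType) (K : Type) (b : K -> set X) :
  embeds I K -> (forall k, open (b k)) ->
  (forall (U : set X) x, open U -> U x -> exists k, b k x /\ b k `<=` U) ->
  weight_le X I.
Proof.
move=> [f fi] ob bP.
exists (fun i => \bigcup_(k in [set k | f k = i]) b k); split.
  by move=> i; apply: bigcup_open => k _; exact: ob.
move=> U x oU Ux; have [k [bx bU]] := bP U x oU Ux.
exists (f k); split; first by exists k.
by move=> y [k' /fi ->] /bU.
Qed.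

Lemma weight_le_set_type (X : topologicalType) (A : set X) :
  weight_le X I -> weight_le (set_type A) I.
Proof.
move=> [b [ob bP]]; exists (fun i => set_val @^-1` b i); split.
  by move=> i; exists (b i).
move=> _ x [V oV <-] Vx; have [i [bx bV]] := bP _ _ oV Vx.
by exists i; split=> // y /bV.
Qed.

Lemma seq_of_finite (T : Type) (A : set T) : finite_set A ->
  exists s : seq T, A = [set x | List.In x s].
Proof.
by move=> /finite_setE[s sE]; exists s; apply/seteqP; split=> x /sE.
Qed.

(** The map [f] is closed, so complements of images of closed sets are open. Finite unions of base
    sets are taken because a whole compact fibre has to be covered. *)
Lemma weight_le_image (Y P : topologicalType) (f : Y -> P) :
  compact [set: Y] -> hausdorff_space P -> continuous f ->
  (forall p, exists y, f y = p) -> weight_le Y I -> weight_le P I.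
Proof.
move=> cY hP cf sf [b [ob bP]].
pose B (s : seq I) := \bigcup_(i in [set i | List.In i s]) b i.
have oB s : open (B s) by apply: bigcup_open => i _; exact: ob.
apply: (@weight_le_base _ _ (fun s => ~` (f @` (~` B s)))).
- exact/embeds_seq/embeds_id.
- move=> s; apply: closed_openC; apply: compact_closed => //.
  apply: continuous_compact; first exact: continuous_subspaceT.
  by apply: subclosed_compact cY _ => //; exact: open_closedC.
- move=> U p oU Up.
  have cp : compact (f @^-1` [set p]).
    apply: subclosed_compact cY _ => //; apply: closed_preimage => //.
    exact/accessible_closed_set1/hausdorff_accessible.
  have [||F [fF FU pF]] := @compact_finite_cover _ _ _ [set i | b i `<=` f @^-1` U] b cp.
  + by move=> i _; exact: ob.
  + move=> y yp; have [|i [bi iU]] := bP (f @^-1` U) y (open_preimage cf oU).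
      by rewrite /= yp.
    by exists i.
  have [s Fs] := seq_of_finite fF; exists s; rewrite /B -Fs; split.
    by move=> [y nB yp]; apply: nB; exact: pF.
  move=> q nq; have [y yq] := sf q; apply: contrapT => nU; apply: nq.
  exists y => // -[i /FU iU /iU]; rewrite /= yq => Uq; exact: nU.
Qed.

Lemma weight_le_countable (X : topologicalType) (b : nat -> set X) :
  (forall k, open (b k)) ->
  (forall (U : set X) x, open U -> U x -> exists k, b k x /\ b k `<=` U) ->
  weight_le X I.
Proof. by apply: weight_le_base; exact: embeds_nat. Qed.

End Weight.

(** * Function spaces with the pointwise topology *)

Section Pointwise.
Variables (J : Type) (V : topologicalType).

Lemma continuous_proj (j : J) : continuous (fun y : {ptws J -> V} => y j).
Proof. by elim/Peq : J j => J' j; exact: (@proj_continuous J' (fun=> V) j). Qed.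

Lemma continuous_to_ptws (Z : topologicalType) (f : Z -> {ptws J -> V}) :
  (forall j, continuous (fun z => f z j)) -> continuous f.
Proof.
move=> cf z; apply/cvg_sup => j U [_ [[W oW <-] Wz] WU].
by apply: (filterS WU); exact: (cf j z _ (open_near oW Wz)).
Qed.

Lemma hausdorff_ptws : hausdorff_space V -> hausdorff_space {ptws J -> V}.
Proof. by elim/Peq : J => J' hV; exact: (@hausdorff_product J' (fun=> V)). Qed.

Lemma compact_ptws : compact [set: V] -> compact [set: {ptws J -> V}].
Proof.
elim/Peq : J => J'; move=> cV.
have := @tychonoff J' (fun=> V) (fun=> setT) (fun=> cV).
by congr compact; apply/seteqP; split.
Qed.

Variable b : nat -> set V.
Hypothesis b_open : forall k, open (b k).
Hypothesis b_base : forall (U : set V) x, open U -> U x -> exists k, b k x /\ b k `<=` U.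

(** A basic set for the topology induced by the coordinates [c]. Leaving [c] general lets the
    factorization use it on quotients as well as on products. *)
Definition cylinder (Y : Type) (c : J -> Y -> V) (s : seq (J * nat)) : set Y :=
  [set y | forall p, List.In p s -> b p.2 (c p.1 y)].

Lemma cylinder_cat (Y : Type) (c : J -> Y -> V) s1 s2 :
  cylinder c (s1 ++ s2) = cylinder c s1 `&` cylinder c s2.
Proof.
apply/seteqP; split=> y.
  by move=> ys; split=> p ps; apply: ys; apply: List.in_or_app; [left|right].
by move=> [y1 y2] p ps; have [/y1|/y2] := List.in_app_or _ _ _ ps.
Qed.

Lemma open_cylinder (Y : topologicalType) (c : J -> Y -> V) s :
  (forall j, continuous (c j)) -> open (cylinder c s).
Proof.
move=> cc; elim: s => [|p s IH].
  rewrite (_ : cylinder _ _ = setT); [exact: openT|].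
  by apply/seteqP; split=> // y _ p [].
rewrite (_ : cylinder c _ = c p.1 @^-1` b p.2 `&` cylinder c s).
  by apply: openI => //; exact: open_preimage.
apply/seteqP; split=> [y ys|y [yp ys] q [<-//|/ys//]].
by split=> [|q qs]; apply: ys; [left|right].
Qed.

(** The filter generated by the cylinders around [y] converges to [y] in each coordinate, hence in
    the product. *)
Lemma ptws_cylinder_base (U : set {ptws J -> V}) (y : {ptws J -> V}) : open U -> U y ->
  exists s, cylinder (fun j (y : {ptws J -> V}) => y j) s y /\
    cylinder (fun j (y : {ptws J -> V}) => y j) s `<=` U.
Proof.
move=> oU Uy; pose cyl := cylinder (fun j (y : {ptws J -> V}) => y j).
pose F := filter_from [set s | cyl s y] cyl.
have FF : Filter F.
  apply: filter_from_filter; first by exists [::].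
  by move=> s1 s2 y1 y2; exists (s1 ++ s2); rewrite /= /cyl cylinder_cat.
suff Fy : F --> y by have [s ys sU] := Fy _ (open_near oU Uy); exists s.
apply/cvg_sup => j W [_ [[W0 oW0 <-] W0y] OW].
have [k [by_ bO]] := b_base oW0 W0y.
exists [:: (j, k)]; first by move=> p [<-|].
by move=> z zs; apply: OW; apply: bO; apply: (zs (j, k)); left.
Qed.

End Pointwise.

Lemma hausdorff_unit : hausdorff_space unit_interval.
Proof. exact/hausdorff_set_type/Rhausdorff. Qed.

Lemma compact_unit : compact [set: unit_interval].
Proof.
apply/compact_set_type; rewrite (_ : unitI = `[0, 1]%classic); first exact: segment_compact.
by apply/seteqP; split=> x; rewrite /= in_itv.
Qed.

Lemma hausdorff_cube (J : Type) : hausdorff_space (tych_cube J).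
Proof. exact/hausdorff_ptws/hausdorff_unit. Qed.

Lemma compact_cube (J : Type) : compact [set: tych_cube J].
Proof. exact/compact_ptws/compact_unit. Qed.

(** One function for each pair of base sets that can be separated is enough to distinguish points,
    and there are no more pairs than elements of [I]. *)
Lemma cube_embedding (I : Type) (K : topologicalType) :
  infinite_set [set: I] -> hausdorff_space K -> compact [set: K] -> weight_le K I ->
  exists j : K -> tych_cube I, continuous j /\ injective j.
Proof.
move=> I_inf hK cK [b [ob bP]]; have tK := compact_tychonoff hK cK.
pose sep (u : I * I) (f : K -> unit_interval) := [/\ continuous f,
  forall x, b u.1 x -> set_val (f x) = 0 & forall x, ~ b u.2 x -> set_val (f x) = 1].
have /choice[f fP] (u : I * I) : exists f : K -> unit_interval, continuous f /\
    ((exists f, sep u f) -> sep u f).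
  have [[f sf]|ns] := pselect (exists f, sep u f).
    by exists f; split=> //; case: sf.
  by exists (fun=> to_unit 0); split=> // x; exact: continuous_cst_at.
have [p pI] := embeds_prod I_inf (embeds_id I) (embeds_id I).
(* [q] inverts [p] on its range; elsewhere [(i, i)] merely repeats a function of the family. *)
have /choice[q qP] i : exists u : I * I, (exists u', p u' = i) -> p u = i.
  by have [[u pu]|n] := pselect (exists u', p u' = i); [exists u|exists (i, i)].
have qp u : q (p u) = u by apply: pI; apply: qP; exists u.
exists (fun x i => f (q i) x); split.
  by apply: continuous_to_ptws => i; exact: (fP (q i)).1.
move=> x y fxy; apply: contrapT => nxy.
have cy : closed [set y] by exact/accessible_closed_set1/hausdorff_accessible.
have [i' [xi' i'y]] := bP _ x (closed_openC cy) nxy.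
have [|phi [cphi phi0 phi1]] := tychonoff_unit tK (open_closedC (ob i')) (x := x).
  by apply.
have cr : continuous (fun z => set_val (phi z)).
  exact: continuous_val_comp.
have [|i [xi iphi]] := bP _ x (continuous_gt (1/2) cr); first by rewrite /= phi0; lra.
have [_ f0 f1] : sep (i, i') (f (i, i')).
  (* After clamping, [2 phi - 1] is 0 where [phi < 1/2], hence on [b i], and it is still 1 where
     [phi = 1]. *)
  apply: (fP (i, i')).2; exists (fun z => to_unit (2 * set_val (phi z) - 1)); split.
  - move=> z; apply: (@continuous_comp_at _ _ _ (fun z => 2 * set_val (phi z) - 1));
      last exact: continuous_to_unit.
    apply: (@continuousB RR RR^o _ (fun z => 2 * set_val (phi z)) (fun=> 1));
      last exact: continuous_cst_at.
    by apply: (@continuousM RR _ (fun=> 2) (fun z => set_val (phi z)));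
      [exact: continuous_cst_at|exact: cr].
  - by move=> z /iphi /= pz; rewrite to_setK clamp01_le0//; lra.
  - by move=> z /phi1 pz; rewrite to_setK pz clamp01_ge1//; lra.
have := congr1 (fun g : tych_cube I => set_val (g (p (i, i')))) fxy.
rewrite /= qp f0// f1; last by move=> /i'y; apply.
by move=> /eqP; rewrite eq_sym oner_eq0.
Qed.

(** * Stone-Cech compactifications and disjoint sums *)

Lemma stone_cech_exists (X : topologicalType) : tychonoff_sp X ->
  exists (Z : topologicalType) (e : X -> Z), stone_cech e.
Proof.
move=> tX; pose J := {f : X -> unit_interval | continuous f}.
pose e0 (x : X) : {ptws J -> unit_interval} := fun j => projT1 j x.
have ce0 : continuous e0.
  by apply: continuous_to_ptws => j; exact: projT2 j.
pose Zs := closure (range e0).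
have Ze x : Zs (e0 x) by apply: subset_closure; exists x.
pose e x : set_type Zs := to_set (Ze x).
have ce : continuous e by exact: continuous_to_set_type.
exists (set_type Zs : topologicalType), e; split; [|split; [|split; [|split; [|split; [|split]]]]].
- apply/compact_set_type; apply: subclosed_compact (compact_cube (J := J)) _ => //.
  exact: closed_closure.
- exact/hausdorff_set_type/hausdorff_cube.
- exact: ce.
- move=> x y exy; apply: contrapT => nxy.
  have cy : closed [set y] by apply/accessible_closed_set1/hausdorff_accessible; case: tX.
  have [f [cf f0 f1]] := tychonoff_unit tX cy (x := x) nxy.
  have fxy : f x = f y :=
    congr1 (fun z : set_type Zs => set_val z (exist _ f cf : J)) exy.
  have := f1 y erefl; rewrite -fxy f0 => /eqP.
  by rewrite eq_sym oner_eq0.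
- move=> U oU.
  have /choice[V VP] x : exists V : set (set_type Zs), open V /\
      (U x -> V (e x) /\ forall z, V (e z) -> U z).
    have [Ux|nUx] := pselect (U x); last by exists setT; split; [exact: openT|].
    have [|f [cf f0 f1]] := tychonoff_unit tX (open_closedC oU) (x := x); first by apply.
    exists [set z | set_val (set_val z (exist _ f cf : J)) < 1]; split.
      apply: continuous_gt; apply: continuous_val_comp => z.
      apply: (@continuous_comp_at _ _ _ set_val (fun y : {ptws J -> unit_interval} => y _)).
        exact: continuous_set_val.
      exact: continuous_proj.
    move=> _; split=> [|z] /=; first by rewrite /e0 /= f0.
    rewrite /e0 /= => fz; apply: contrapT => /f1 fz1.
    by rewrite fz1 ltxx in fz.
  exists (\bigcup_(x in U) V x); split.
    by apply: bigcup_open => x _; have [] := VP x.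
  apply/seteqP; split=> [_ [x Ux <-]|y [[x Ux Vz] [z _ ze]]].
    by split; [exists x => //; have [_ /(_ Ux)[]] := VP x|exists x].
  exists z => //; have [_ /(_ Ux)[_ ]] := VP x; apply.
  by rewrite ze.
- move=> _ [W oW <-] [z /= Wz].
  have [y [[x _ xy] Wy]] := set_val_mem z W (open_near oW Wz).
  by rewrite -xy in Wy; exists (e x); split; [exact: Wy|exists x].
- move=> f cf; exists (fun z => set_val z (exist _ f cf : J)); split=> // z.
  apply: (@continuous_comp_at _ _ _ set_val (fun y : {ptws J -> unit_interval} => y _)).
    exact: continuous_set_val.
  exact: continuous_proj.
Qed.

Section StoneCech.
Variables (X Z : topologicalType) (e : X -> Z) (eZ : stone_cech e).

(** [F z] is a cluster point of the images of the traces of neighbourhoods of [z]. Each function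
    [phi] on [P] has an extension [Phi phi] of [phi \o G], whose value at [z] must be [phi (F z)];
    so all [phi \o F] are continuous. *)
Lemma stone_cech_extend (P : topologicalType) (G : X -> P) :
  compact [set: P] -> hausdorff_space P -> continuous G ->
  exists2 F : Z -> P, continuous F & forall x, F (e x) = G x.
Proof.
move: eZ => [_ [_ [ce [_ [_ [dns ext]]]]]] cP hP cG.
have tP := compact_tychonoff hP cP.
have /choice[Phi PhiP] (phi : P -> unit_interval) : exists F : Z -> unit_interval,
    continuous phi -> continuous F /\ forall x, F (e x) = phi (G x).
  have [cphi|nc] := pselect (continuous phi); last by exists (fun=> to_unit 0).
  have [|F [cF FE]] := ext (phi \o G).
    by move=> x; apply: (@continuous_comp_at _ _ _ G phi); [exact: cG|exact: cphi].
  by exists F.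
have /choice[F FP] z : exists p, forall phi, continuous phi -> phi p = Phi phi z.
  pose B (V : set Z) := G @` (e @^-1` V).
  pose Fz := filter_from (nbhs z) B.
  have FF : ProperFilter Fz.
    apply: filter_from_proper; last first.
      move=> V; rewrite nbhsE => -[W [oW Wz] WV].
      have [|y [Wy [x _ xy]]] := dns W oW; first by exists z.
      by exists (G x), x => //; rewrite /= xy; exact: WV.
    apply: filter_from_filter; first by exists setT; exact: filterT.
    move=> V W nV nW; exists (V `&` W); first exact: filterI.
    by move=> _ [x [Vx Wx] <-]; split; exists x.
  have [p [_ clp]] := cP Fz FF (filterT).
  exists p => phi cphi; have [cF FE] := PhiP phi cphi.
  apply: hausdorff_unit => U W Up Wz.
  have FB : Fz (B (Phi phi @^-1` W)).
    by exists (Phi phi @^-1` W) => //; exact: (cF _ _ Wz).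
  have [_ [[x /= Wx <-] Ux]] := clp _ (phi @^-1` U) FB (cphi _ _ Up).
  by exists (phi (G x)); split=> //; rewrite -FE.
exists F.
  apply: continuous_to_tychonoff => // phi cphi.
  have -> : phi \o F = Phi phi by apply/funext => z; exact: FP.
  by have [] := PhiP phi cphi.
move=> x; apply: contrapT => nF.
have cy : closed [set G x] by exact/accessible_closed_set1/hausdorff_accessible.
have [f [cf f0 f1]] := tychonoff_unit tP cy (x := F (e x)) nF.
have [_ fE] := PhiP f cf.
have := f1 _ erefl; rewrite -fE -FP// f0 => /eqP.
by rewrite eq_sym oner_eq0.
Qed.

Lemma stone_cech_eq (L : topologicalType) (f g : Z -> L) (U : set Z) :
  hausdorff_space L -> open U -> {in U, continuous f} -> {in U, continuous g} ->
  (forall x, U (e x) -> f (e x) = g (e x)) -> forall z, U z -> f z = g z.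
Proof.
move: eZ => [_ [_ [_ [_ [_ [dns _]]]]]] hL oU cf cg fg z Uz.
apply: hL => A B fA gB.
have := cf z (mem_set Uz) A fA; have := cg z (mem_set Uz) B gB.
rewrite !nbhs_simpl /= => nB nA.
have : nbhs z (U `&` (f @^-1` A `&` g @^-1` B)).
  by apply: filterI (open_near oU Uz) _; exact: filterI.
rewrite nbhsE => -[W [oW Wz] WU].
have [|y [Wy [x _ xy]]] := dns W oW; first by exists z.
have [Ux [Ax Bx]] := WU _ Wy; rewrite -xy in Ux Ax Bx.
by exists (f (e x)); split=> //; rewrite fg.
Qed.

End StoneCech.

Section Sum.
Variables (K : choiceType) (X : K -> topologicalType).

Lemma edim_sigT (L : topologicalType) (l0 : L) :
  (forall i, edim_le (X i) L) -> edim_le {i & X i} L.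
Proof.
move=> eX; apply: (edim_leI l0) => A g h clA ch h01 hA cg.
have cE i : continuous (existT X i) by exact: existT_continuous.
have Gex i : exists G : X i -> L, continuous G /\
    forall x, A (existT X i x) -> G x = g (existT X i x).
  have [|||||G cG GA] := @edim_extend L (X i) (existT X i @^-1` A)
    (fun x => g (existT X i x)) (fun x => h (existT X i x)) 1 (eX i).
  - exact: closed_preimage.
  - by move=> x; apply: (@continuous_comp_at _ _ _ (existT X i) h); [exact: cE|exact: ch].
  - exact: ltr01.
  - by move=> x Ax; rewrite hA.
  - by move=> x hx; apply: (@continuous_comp_at _ _ _ (existT X i) g); [exact: cE|exact: cg].
  by exists G.
exists (fun u => projT1 (cid (Gex (projT1 u))) (projT2 u)).
  by apply: (@sigT_continuous _ _ _ (fun i => projT1 (cid (Gex i)))) => i;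
    have [] := projT2 (cid (Gex i)).
by move=> [i x] Ax /=; have [_] := projT2 (cid (Gex i)); exact.
Qed.

Lemma tychonoff_sigT :
  (forall i, tychonoff_sp (X i)) -> tychonoff_sp {i & X i}.
Proof.
move=> tX; split; first by apply: sigT_hausdorff => i; case: (tX i).
move=> B [i x] cB nBx.
have fex j : exists f : X j -> RR, [/\ continuous f,
    forall y, existT X j y = existT X i x -> f y = 0 &
    forall y, B (existT X j y) -> f y = 1].
  have [[y yx]|ny] := pselect (exists y, existT X j y = existT X i x); last first.
    exists (fun=> 1); split=> //; first by move=> y; exact: continuous_cst_at.
    by move=> y yx; case: ny; exists y.
  have [_ /(_ (existT X j @^-1` B) y)[||f [cf [f0 f1]]]] := tX j.
  - by apply: closed_preimage => //; exact: existT_continuous.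
  - by rewrite /= yx.
  exists f; split=> // y' y'x; rewrite -f0; congr f.
  exact: (existT_inj2 (etrans y'x (esym yx))).
exists (fun u => projT1 (cid (fex (projT1 u))) (projT2 u)); split.
  by apply: (@sigT_continuous _ _ _ (fun j => projT1 (cid (fex j)))) => j;
    have [] := projT2 (cid (fex j)).
split.
  by have [_ + _] := projT2 (cid (fex i)); exact.
by move=> [j y] By /=; have [_ _] := projT2 (cid (fex j)); exact.
Qed.

End Sum.

(** * Factorization *)

Definition real_base : nat -> set RR := projT1 (cid RR_countable_base).

Lemma open_real_base k : open (real_base k).
Proof. exact: (projT2 (cid RR_countable_base)).1. Qed.

Lemma real_baseP (U : set RR) x : open U -> U x ->
  exists k, real_base k x /\ real_base k `<=` U.
Proof. exact: (projT2 (cid RR_countable_base)).2. Qed.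

Lemma rV_separating_family m : exists O : nat -> set 'rV[RR]_m,
  (forall o, open (O o)) /\
  forall K N, compact K -> open N -> K `<=` N -> exists o, K `<=` O o /\ O o `<=` N.
Proof.
by have [b [ob bP]] := rV_countable_base m; exact: countable_separating_family ob bP.
Qed.

Definition rV_open m : nat -> set 'rV[RR]_m := projT1 (cid (rV_separating_family m)).

Lemma open_rV_open m o : open (@rV_open m o).
Proof. exact: (projT2 (cid (rV_separating_family m))).1. Qed.

Lemma rV_openP m (K N : set 'rV[RR]_m) : compact K -> open N -> K `<=` N ->
  exists o, K `<=` rV_open o /\ rV_open o `<=` N.
Proof. exact: (projT2 (cid (rV_separating_family m))).2. Qed.

(** * Closing a family of functions under approximate solutions *)

Section Closure.
Variables (I : Type) (X : topologicalType) (F0 : I -> X -> RR).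
Hypothesis F0_cont : forall i, continuous (F0 i).

(* The entry [(s, o)] of [l] requires [psi] to map the set where the functions
   [fs_i] lie in [real_base k], for [(i, k)] in [s], into [rV_open o]. *)
Definition solves m (fs : seq (X -> RR)) (l : seq (seq (nat * nat) * nat))
    (psi : X -> 'rV[RR]_m) :=
  continuous psi /\ forall p, List.In p l -> forall x,
    (forall q, List.In q p.1 -> real_base q.2 (nth (fun=> 0) fs q.1 x)) ->
    rV_open p.2 (psi x).

(** The number [n] codes a dimension, a coordinate and a problem, so there are countably many
    operations. The solution is chosen independently of the coordinate [k], so the coordinates
    obtained for different [k] fit together. *)
Definition chosen_coord (n : nat) (fs : seq (X -> RR)) : X -> RR :=
  if unpickle n is Some (m, k, l) then
    match pselect (exists psi : X -> 'rV[RR]_m, solves fs l psi) with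
    | left ex => fun x => if insub k is Some i then projT1 (cid ex) x 0 i else 0
    | right _ => fun=> 0
    end
  else fun=> 0.

(** Terms over [F0], a node label being the code of an operation. The family is closed under the
    operations by construction, and for infinite [I] its index type injects into [I]. *)
Fixpoint interp (t : GenTree.tree I) : X -> RR :=
  match t with
  | GenTree.Leaf i => F0 i
  | GenTree.Node n ts => chosen_coord n (map interp ts)
  end.

Lemma continuous_interp t : continuous (interp t).
Proof.
case: t => [i|n ts]; first exact: F0_cont.
rewrite /= /chosen_coord; case: unpickle => [[[m k] l]|]; last first.
  by move=> x; exact: continuous_cst_at.
case: pselect => [ex|_]; last by move=> x; exact: continuous_cst_at.
case: insubP => [i _ _|_]; last by move=> x; exact: continuous_cst_at.
have [cpsi _] := projT2 (cid ex).
by move=> x; apply: continuous_coord_at; exact: cpsi.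
Qed.

Lemma interp_solves m (ts : seq (GenTree.tree I)) l :
  (exists psi : X -> 'rV[RR]_m, solves (map interp ts) l psi) ->
  exists (psi : X -> 'rV[RR]_m) (j : 'I_m -> GenTree.tree I),
    solves (map interp ts) l psi /\ forall i x, interp (j i) x = psi x 0 i.
Proof.
move=> ex; exists (projT1 (cid ex)).
exists (fun i => GenTree.Node (pickle (m, nat_of_ord i, l)) ts).
split; first exact: (projT2 (cid ex)).
move=> i x; rewrite /= /chosen_coord pickleK.
case: pselect => [ex'|//]; rewrite (Prop_irrelevance ex' ex).
by rewrite valK.
Qed.

End Closure.

Lemma seq_index (T : Type) (d : T) (ts : seq T) : exists idx : T -> nat,
  forall t, List.In t ts -> (idx t < size ts)%N /\ nth d ts (idx t) = t.
Proof.
have /choice[idx idxP] t : exists k, List.In t ts -> (k < size ts)%N /\ nth d ts k = t;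
  last by exists idx.
 have [+|nt] := pselect (List.In t ts); last by exists 0%N.
elim: ts => // x ts IH [->|tts]; first by exists 0%N.
by have [k kP] := IH tts; exists k.+1 => _; exact: kP.
Qed.

Lemma ball_segment (V : normedModType RR) (v p q : V) (e l : RR) :
  0 <= l <= 1 -> ball v e p -> ball v e q -> ball v e (q + (1 - l) *: (p - q)).
Proof.
move=> /andP[l0 l1]; rewrite -ball_normE /ball_ /= => vp vq.
have -> : v - (q + (1 - l) *: (p - q)) = (1 - l) *: (v - p) + l *: (v - q).
  have -> : l *: (v - q) = v - q - (1 - l) *: (v - q).
    by rewrite scalerBl scale1r opprB [RHS]addrC subrK.
  rewrite addrCA -scalerBr opprD addrA -scalerN; congr (_ + _ *: _).
  by rewrite !opprB [RHS]addrC addrA subrK.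
apply: le_lt_trans (ler_normD _ _) _; rewrite !normrZ.
rewrite (ger0_norm l0) ger0_norm; last by rewrite subr_ge0.
have [->|/eqP nl] := pselect (l = 0); first by rewrite subr0 mul1r mul0r addr0.
have lp : 0 < l by rewrite lt_neqAle eq_sym nl.
have a1 : (1 - l) * `|v - p| <= (1 - l) * e by rewrite ler_wpM2l ?subr_ge0// ltW.
have a2 : l * `|v - q| < l * e by rewrite ltr_pM2l.
lra.
Qed.

Section Factorization.
Variables (I : Type) (L : topologicalType) (C : CW_structure L) (l0 : L).
Local Notation J := (GenTree.tree I).

(** An extension [G] over [X] need not factor through [Y]. But the finite problem that it solves
    approximately also has a chosen solution with coordinates among [c]; that one descends to [Y]
    and is corrected to equal [g] on [A]. *)
Lemma quotient_edim (X Y : topologicalType) (F0 : I -> X -> RR) (pi : X -> Y)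
    (c : J -> Y -> RR) :
  edim_le X L -> compact [set: X] -> compact [set: Y] ->
  continuous pi -> (forall y, exists x, pi x = y) ->
  (forall j, continuous (c j)) -> (forall j x, c j (pi x) = interp F0 j x) ->
  (forall (U : set Y) y, open U -> U y -> exists s,
     cylinder real_base c s y /\ cylinder real_base c s `<=` U) ->
  edim_le Y L.
Proof.
move=> eX cX cY cpi spi cc cE cbase.
apply: (edim_leI l0) => A g h clA ch h01 hA cg.
have chpi : continuous (h \o pi).
  by move=> x; apply: (@continuous_comp_at _ _ _ pi h); [exact: cpi|exact: ch].
(* Extending from the set [1/2 <= h] rather than from [A] leaves a band in which the approximate
   solution can be interpolated with [g]. *)
have [|||||G cG GE] := @edim_extend L X [set x | 1/2 <= h (pi x)] (g \o pi) (h \o pi) (1/2) eX.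
- exact: continuous_le.
- exact: chpi.
- lra.
- by [].
- by move=> x hx; apply: (@continuous_comp_at _ _ _ pi g); [exact: cpi|exact: cg].
have cGX : compact (range G).
  by apply: continuous_compact => //; exact: continuous_subspaceT.
have [S [fS GS]] := compact_in_finite_subcomplex C cGX.
have [m [phi [N [r [cphi oN Nr phiN]]]]] := finite_subcomplex_retract l0 fS.
have cP := finite_subcomplex_compact fS.
have [|o0 [Po0 o0N]] := rV_openP (continuous_compact cphi cP) oN.
  by move=> _ [p /phiN[Np _] <-].
have GP x : cw_carrier S (G x) by apply: GS; exists x.
have gP y : 1/2 <= h y -> cw_carrier S (g y).
  by have [x <-] := spi y => hy; rewrite -(GE x hy : G x = g (pi x)).
have cphiG (Z : topologicalType) (k : Z -> L) (z : Z) : {for z, continuous k} ->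
    (\near z, cw_carrier S (k z)) -> {for z, continuous (fun z => phi (k z))}.
  move=> ck nk; move: cphi => /subspace_continuousP/(_ _ (nbhs_singleton nk)) cp W /cp.
  rewrite !nbhs_simpl /= => /ck; rewrite nbhs_simpl /=.
  by move: nk; apply: filterS2 => w Sw; apply.
pose psi x := phi (G x).
have cpsi : continuous psi.
  by move=> x; apply: cphiG; [exact: cG|exact: (@filterE _ (nbhs x))].
pose gam y := phi (g y).
have cgam y : 1/2 < h y -> {for y, continuous gam}.
  move=> hy; apply: cphiG; first by apply: cg; lra.
  have : nbhs y [set z | 1/2 < h z] by apply: open_near => //; exact: continuous_lt.
  by apply: filterS => z /= /ltW; exact: gP.
(* An admissible entry is a cylinder on which [gam] stays in an open set contained in a ball inside
   [N]; the convexity of the ball will keep segments in [N]. *)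
pose D := [set u : seq (J * nat) * nat |
  cylinder real_base c u.1 `<=` [set y | 1/2 < h y /\ rV_open u.2 (gam y)] /\
  exists (v : 'rV[RR]_m) (e : RR), rV_open u.2 `<=` ball v e /\ ball v e `<=` N].
have cB : compact [set y | 3/4 <= h y].
  by apply: subclosed_compact cY _ => //; exact: continuous_le.
have [||F [fF FD BF]] := @compact_finite_cover _ _ _ D
  (fun u => cylinder real_base c u.1) cB.
- by move=> u _; apply: open_cylinder => //; exact: open_real_base.
- move=> y /= hy.
  have hy2 : 1/2 < h y by lra.
  have [Ng _] := phiN _ (gP y (ltW hy2)).
  have /nbhs_ballP[e /= e0 eN] := open_near oN Ng.
  have [|||o [go oe]] := @rV_openP _ [set gam y] (ball (gam y) e).
  + exact: compact_set1.
  + exact: ball_open.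
  + by move=> _ ->; exact: ballxx.
  have ngo : nbhs y [set z | 1/2 < h z /\ rV_open o (gam z)].
    apply: filterI; first by apply: open_near => //; exact: continuous_lt.
    by apply: (continuous_near (cgam y hy2)); [exact: open_rV_open|exact: go].
  move: ngo; rewrite nbhsE => -[W [oW Wy] WU].
  have [s [ys sW]] := cbase W y oW Wy.
  exists (s, o) => //; split; last by exists (gam y), e.
  by move=> z /sW/WU.
have [us usF] := seq_of_finite fF.
(* A problem refers to functions by their positions in a list, so that a natural number can code it.
   [idx] replaces the trees that occur in the cylinders by positions in [ts]. *)
pose ts := flatten [seq [seq q.1 | q <- u.1] | u <- us].
have tsP u q : List.In u us -> List.In q u.1 -> List.In q.1 ts.
  rewrite /ts; elim: us {usF ts} => //= u' us IH [->|uus] qu; apply: List.in_or_app.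
    by left; apply: (List.in_map fst).
  by right; exact: IH.
have [idx idxP] := seq_index (GenTree.Node 0 [::]) ts.
(* The entry without conditions keeps the whole solution in [N]; the others keep it near [gam] where
   [h >= 3/4]. *)
pose l := ([::], o0) :: [seq ([seq (idx q.1, q.2) | q <- u.1], u.2) | u <- us].
have cyl x u : List.In u us ->
    (forall q, List.In q [seq (idx q.1, q.2) | q <- u.1] ->
      real_base q.2 (nth (fun=> 0) (map (interp F0) ts) q.1 x)) <->
    cylinder real_base c u.1 (pi x).
  move=> uus; split=> [H q qu|H q /(List.in_map_iff _ _ _).1[q' [<- q'u]]] /=.
    have [iq1 iq2] := idxP _ (tsP _ _ uus qu).
    have := H (idx q.1, q.2) (List.in_map (fun q => (idx q.1, q.2)) _ _ qu).
    by rewrite /= (nth_map (GenTree.Node 0 [::]))// iq2 cE.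
  have [iq1 iq2] := idxP _ (tsP _ _ uus q'u).
  by rewrite (nth_map (GenTree.Node 0 [::]))// iq2 -cE; exact: H.
have [|psi' [j [[cpsi' psi'P] jE]]] := @interp_solves _ _ F0 m ts l.
  exists psi; split=> // p [<-|/(List.in_map_iff _ _ _).1[u [<- uus]]] x.
    by move=> _; apply: Po0; exists (G x).
  move=> /(cyl x u uus); have [uD _] : D u by apply: FD; rewrite usF.
  by move=> /uD[hx]; rewrite /psi GE//= ltW.
pose Psi y : 'rV[RR]_m := \row_i c (j i) y.
have cPsi : continuous Psi.
  move=> y; apply: continuous_rV => i.
  by apply: (continuous_ext_at (cc (j i) y)) => z; rewrite mxE.
have PsiE x : Psi (pi x) = psi' x by apply/rowP => i; rewrite mxE cE jE.
have PsiN y : N (Psi y).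
  have [x <-] := spi y; rewrite PsiE; apply: o0N.
  by apply: (psi'P ([::], o0)); [left|].
(* [lam] is 0 on [A] and 1 for [h <= 3/4]. So [mu] is [gam] on [A], and it is [Psi] on a region that
   includes [h <= 1/2], where [gam] may be discontinuous. *)
pose lam y := clamp01 (4 * (1 - h y)).
have clam : continuous lam.
  move=> y; apply: (@continuous_comp_at _ _ _ (fun y => 4 * (1 - h y)) clamp01);
    last exact: continuous_clamp01.
  apply: (@continuousM RR _ (fun=> 4) (fun y => 1 - h y)); first exact: continuous_cst_at.
  by apply: (@continuousB RR RR^o _ (fun=> 1) h); [exact: continuous_cst_at|exact: ch].
pose mu y := Psi y + (1 - lam y) *: (gam y - Psi y).
have muPsi y : h y <= 3/4 -> mu y = Psi y.
  by move=> hy; rewrite /mu /lam clamp01_ge1 ?subrr ?scale0r ?addr0//; lra.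
have cmu : continuous mu.
  move=> y; have [hy|hy] := ltP (1/2) (h y).
    apply: (@continuousD RR _ _ Psi (fun y => (1 - lam y) *: (gam y - Psi y))).
      exact: cPsi.
    apply: (@continuousZ RR _ _ (fun y => 1 - lam y) (fun y => gam y - Psi y)).
      by apply: (@continuousB RR RR^o _ (fun=> 1) lam);
        [exact: continuous_cst_at|exact: clam].
    by apply: (@continuousB RR _ _ gam Psi); [exact: cgam|exact: cPsi].
  apply: (cvg_near_eq (cPsi y)).
  have : nbhs y [set z | h z < 3/4].
    by apply: open_near; [exact: continuous_gt|rewrite /=; lra].
  by apply: filterS => z /= /ltW/muPsi.
(* For [h >= 3/4] both ends of the segment, [gam y] and [Psi y], satisfy the same entry, hence lie
   in the same ball inside [N]. *)
have muN y : N (mu y).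
  have [hy|hy] := ltP (h y) (3/4); first by rewrite muPsi ?ltW.
  have [u Fu yu] := BF y hy.
  have [/(_ y yu)[_ gu] [v [e [ue eN]]]] := FD _ Fu.
  apply: eN; apply: ball_segment; [exact: clamp01_itv|exact: ue|apply: ue].
  have uus : List.In u us by rewrite usF in Fu.
  have [x xy] := spi y; rewrite -xy PsiE.
  have := psi'P ([seq (idx q.1, q.2) | q <- u.1], u.2); apply.
    by right; apply: (List.in_map (fun u => ([seq (idx q.1, q.2) | q <- u.1], u.2))).
  by apply/(cyl x u uus); rewrite xy.
exists (r \o mu).
  move=> y; apply: (@continuous_comp_at _ _ _ mu r); first exact: cmu.
  by have [] := Nr _ (muN y).
move=> y Ay /=; rewrite /mu /lam hA// subrr mulr0 clamp01_le0// subr0 scale1r subrKC.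
by have [|_ ->] := phiN (g y); first by apply: gP; rewrite hA//; lra.
Qed.

Definition tree_coords (y : {ptws J -> RR}) : tych_cube I :=
  fun i => to_unit (y (GenTree.Leaf i)).

Lemma continuous_tree_coords : continuous tree_coords.
Proof.
apply: continuous_to_ptws => i y.
apply: (@continuous_comp_at _ _ _ (fun y : {ptws J -> RR} => y (GenTree.Leaf i)) to_unit).
  exact: continuous_proj.
exact: continuous_to_unit.
Qed.

(** A leaf [i] is interpreted as the coordinate [i] of [f], so [tree_coords] recovers [f]. Neither
    this map nor the ambient space of [T] depends on [X], which makes a sum over all such [T]
    possible. *)
Lemma compact_factorization (X : topologicalType) (f : X -> tych_cube I) :
  compact [set: X] -> edim_le X L -> continuous f ->
  exists T : set {ptws J -> RR}, [/\ compact T, edim_le (set_type T) L &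
    exists2 p : X -> set_type T, continuous p &
      forall x, tree_coords (set_val (p x)) = f x].
Proof.
move=> cX eX cf; pose F0 i x := set_val (f x i).
have cF0 i : continuous (F0 i).
  apply: continuous_val_comp => x.
  apply: (@continuous_comp_at _ _ _ f (fun y : tych_cube I => y i)); first exact: cf.
  exact: continuous_proj.
pose p0 (x : X) : {ptws J -> RR} := fun j => interp F0 j x.
have cp0 : continuous p0.
  by apply: continuous_to_ptws => j; exact: continuous_interp.
pose T := range p0.
have Tp x : T (p0 x) by exists x.
have cT : compact T by apply: continuous_compact => //; exact: continuous_subspaceT.
pose p x := to_set (Tp x).
have cp : continuous p by exact: continuous_to_set_type.
exists T; split=> //.
  apply: (@quotient_edim X (set_type T) F0 p (fun j y => set_val y j)) => //.
  - exact/compact_set_type.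
  - move=> y; have [x _ xy] := set_val_mem y.
    by exists x; apply: set_val_injective.
  - move=> j y; apply: (@continuous_comp_at _ _ _ set_val (fun y : {ptws J -> RR} => y j)).
      exact: continuous_set_val.
    exact: continuous_proj.
  - move=> _ y [W oW <-] Wy.
    have [s [ys sW]] := ptws_cylinder_base real_baseP oW Wy.
    by exists s; split=> // z zs; apply: sW.
exists p => // x; apply/funext => i.
by rewrite /tree_coords /= to_unitK.
Qed.

End Factorization.

(** * The four implications *)

Section Implications.
Variables (L : topologicalType) (C : CW_structure L) (l0 : L).
Let hL : hausdorff_space L := cw_hausdorff L C.

Lemma quasi_finite_stone_cech : quasi_finite C ->
  forall X : topologicalType, tychonoff_sp X -> edim_le X L ->
  forall (Z : topologicalType) (e : X -> Z), stone_cech e -> edim_le Z L.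
Proof.
move=> qf X tX eX Z e eZ.
have [cZ [hZ [ce _]]] := eZ.
apply: (edim_leI l0) => A g h clA ch h01 hA cg.
(* [A] itself may miss the image of [X]. That image is dense in the open set [1/2 < h], so an
   extension that agrees with [g] on the trace of [B] agrees with it on [A]. *)
pose B := [set z | 1/2 <= h z].
have clB : closed B by exact: continuous_le.
have gB z : B z -> {for z, continuous g} by move=> hz; apply: cg; rewrite /B /= in hz; lra.
have wB : {within B, continuous g} by apply: continuous_in_subspaceT => z /[!inE]; exact: gB.
have cB : compact B by exact: subclosed_compact cZ _.
have [K [fK BK]] := compact_in_finite_subcomplex C (continuous_compact wB cB).
have [P [fP [KP conn]]] := qf K fK.
have inK z : B z -> cw_carrier K (g z) by move=> Bz; apply: BK; exists z.
have inP z : B z -> cw_carrier P (g z).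
  by move=> /inK[a Ka az]; exists a => //; exact: KP.
pose gZ (z : set_type B) : set_type (cw_carrier P) := to_set (inP _ (set_val_mem z)).
have cgZ : continuous gZ by apply: continuous_to_set_type; exact/within_set_val.
pose D := e @^-1` B.
pose gX (a : set_type D) : set_type [set p : set_type (cw_carrier P) | cw_carrier K (set_val p)] :=
  to_set (inK _ (set_val_mem a) :
    [set p : set_type (cw_carrier P) | cw_carrier K (set_val p)] (to_set (inP _ (set_val_mem a)))).
have cgX : continuous gX.
  do 2 apply: continuous_to_set_type; move=> a.
  apply: (@continuous_comp_at _ _ _ (fun a : set_type D => e (set_val a)) g).
    apply: (@continuous_comp_at _ _ _ set_val e); first exact: continuous_set_val.
    exact: ce.
  by apply: gB; exact: (set_val_mem a).
have clD : closed D by exact: closed_preimage.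
(* Normal placement: a function on [P] is pulled back to [B], extended over the compact [Z] by
   Tietze and restricted to [X]. *)
have [|G [cG GE]] := conn X tX eX D gX clD cgX.
  move=> u cu; have cu' : continuous (u \o gZ).
    by move=> z; apply: (@continuous_comp_at _ _ _ gZ u); [exact: cgZ|exact: cu].
  have [F cF FE] := tietze_compact hZ cZ clB cu'.
  exists (F \o e); split.
    by move=> x; apply: (@continuous_comp_at _ _ _ e F); [exact: ce|exact: cF].
  move=> a; rewrite /= (FE (to_set (set_val_mem a : B (e (set_val a))))) /=.
  by congr u; apply: set_val_injective.
have [|||F cF FE] := @stone_cech_extend _ _ _ eZ _ G.
- by apply/compact_set_type; exact: finite_subcomplex_compact.
- exact: hausdorff_set_type.
- exact: cG.
have cvF : continuous (fun z => set_val (F z)) by exact: continuous_val_comp.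
exists (fun z => set_val (F z)) => // z Az.
apply: (@stone_cech_eq _ _ _ eZ L (fun z => set_val (F z)) g [set z | 1/2 < h z]) => //.
- exact: continuous_lt.
- by move=> x /[!inE] /= hx; apply: gB; exact: ltW.
- move=> x /= hx; have Dx : D x by exact: ltW.
  by rewrite FE (GE (to_set Dx)).
- by rewrite /= hA//; lra.
Qed.

Lemma edim_subsingleton (X : topologicalType) :
  (forall x y : X, x = y) -> edim_le X L.
Proof.
move=> X1; apply: (edim_leI l0) => A g h _ _ _ _ _; exists g => // x.
by apply: (continuous_ext_at (@continuous_cst_at _ _ (g x) x)) => z; rewrite (X1 x z).
Qed.

(** A point is lifted as the constant map of a one-point space, for which the singleton of [l0]
    serves. *)
Lemma L_invertible_surjective (Y T : topologicalType) (f : Y -> T) :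
  L_invertible L f -> forall t, exists y, f y = t.
Proof.
move=> inv t.
have t1 : tychonoff_sp (set_type [set l0]).
  apply: compact_tychonoff; first exact: hausdorff_set_type.
  by apply/compact_set_type; exact: compact_set1.
have e1 : edim_le (set_type [set l0]) L.
  apply: edim_subsingleton => x y; apply: set_val_injective.
  by rewrite (set_val_mem x) (set_val_mem y).
have [|h [_ hE]] := inv _ t1 e1 (fun=> t).
  by move=> x; exact: continuous_cst_at.
by exists (h (to_set (erefl l0 : [set l0] l0))).
Qed.

Section WithIndex.
Variables (I : Type) (I_inf : infinite_set [set: I]).
Local Notation J := (GenTree.tree I).

Lemma stone_cech_universal :
  (forall X : topologicalType, tychonoff_sp X -> edim_le X L ->
   forall (Z : topologicalType) (e : X -> Z), stone_cech e -> edim_le Z L) ->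
  exists (Y : topologicalType) (f : Y -> tych_cube I),
    tychonoff_sp Y /\ compact [set: Y] /\ weight_le Y I /\ edim_le Y L /\
    continuous f /\ L_invertible L f.
Proof.
move=> beta.
pose good (T : set {ptws J -> RR}) := compact T /\ edim_le (set_type T) L.
(* [classic] supplies the choice structure required of the index of a sum. *)
pose K := {classic {T : set {ptws J -> RR} | good T}}.
pose S : K -> topologicalType := fun i => set_type (projT1 (i : {T | good T})).
have hS i : hausdorff_space (S i) by exact/hausdorff_set_type/hausdorff_ptws/Rhausdorff.
have tS : tychonoff_sp {i & S i}.
  apply: tychonoff_sigT => i; apply: compact_tychonoff => //.
  by apply/compact_set_type; case: (projT2 (i : {T | good T})).
have eS : edim_le {i & S i} L.
  by apply: (edim_sigT l0) => i; case: (projT2 (i : {T | good T})).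
have [Z [e eZ]] := stone_cech_exists tS.
have [cZ [hZ [ce _]]] := eZ.
pose f0 (u : {i & S i}) : tych_cube I := tree_coords (set_val (projT2 u)).
have cf0 : continuous f0.
  apply: (@sigT_continuous _ _ _ (fun i (y : S i) => tree_coords (set_val y))) => i y.
  apply: (@continuous_comp_at _ _ _ set_val (@tree_coords I)).
    exact: continuous_set_val.
  exact: continuous_tree_coords.
have [F cF FE] := stone_cech_extend eZ (@compact_cube I) (@hausdorff_cube I) cf0.
(* There is no bound on the weight of [Z], a compactification of a very large sum; factoring [F]
   replaces [Z] by a subset of R^J. *)
have [T [cT eT [p cp pE]]] := compact_factorization C l0 cZ (beta _ tS eS _ _ eZ) cF.
have hT : hausdorff_space (set_type T) by exact/hausdorff_set_type/hausdorff_ptws/Rhausdorff.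
have cT' : compact [set: set_type T] by exact/compact_set_type.
exists (set_type T), (fun y => tree_coords (set_val y)).
split; first exact: compact_tychonoff.
split=> //; split.
  apply: weight_le_set_type.
  apply: (@weight_le_base I _ (seq (J * nat))
    (cylinder real_base (fun j (y : {ptws J -> RR}) => y j))).
  - by apply/(embeds_seq I_inf)/(embeds_prod I_inf);
      [exact/(embeds_tree I_inf)/embeds_id|exact: embeds_nat].
  - move=> s; apply: open_cylinder; first exact: open_real_base.
    by move=> j; exact: continuous_proj.
  - by move=> U x; exact: (ptws_cylinder_base real_baseP).
split=> //; split.
  move=> y; apply: (@continuous_comp_at _ _ _ set_val (@tree_coords I)).
    exact: continuous_set_val.
  exact: continuous_tree_coords.
move=> Z' tZ' eZ' g cg.
have [B [e' eB]] := stone_cech_exists tZ'.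
have [cB [hB [ce' _]]] := eB.
have [G cG GE] := stone_cech_extend eB (@compact_cube I) (@hausdorff_cube I) cg.
have [T1 [cT1 eT1 [p1 cp1 p1E]]] :=
  compact_factorization C l0 cB (beta _ tZ' eZ' _ _ eB) cG.
(* The factor [T1] of the compactification of [Z'] is itself a summand, so the lift runs through
   this summand into [Z] and on to [T] by [p]. *)
pose i1 : K := exist good T1 (conj cT1 eT1).
exists (fun z => p (e (existT S i1 (p1 (e' z))))); split.
  move=> z; apply: (@continuous_comp_at _ _ _ (fun z => e (existT S i1 (p1 (e' z)))) p);
    last exact: cp.
  apply: (@continuous_comp_at _ _ _ (fun z => existT S i1 (p1 (e' z))) e); last exact: ce.
  apply: (@continuous_comp_at _ _ _ (fun z => p1 (e' z)) (existT S i1));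
    last exact: existT_continuous.
  by apply: (@continuous_comp_at _ _ _ e' p1); [exact: ce'|exact: cp1].
by move=> z; rewrite pE FE /f0 /= p1E GE.
Qed.

Lemma universal_connected :
  (exists (Y : topologicalType) (f : Y -> tych_cube I),
    tychonoff_sp Y /\ compact [set: Y] /\ weight_le Y I /\ edim_le Y L /\
    continuous f /\ L_invertible L f) ->
  forall (M : topologicalType) (K : set M),
    tychonoff_sp M -> compact K -> weight_le (set_type K) I -> L_connected L K ->
    exists P : set M, compact P /\ K `<=` P /\ weight_le (set_type P) I /\
      L_connected L [set p : set_type P | K (set_val p)].
Proof.
move=> [Y [f [tY [cY [wY [eY [cf inv]]]]]]] M K [hM _] cK wK conn.
have hY : hausdorff_space Y by case: tY.
have hK : hausdorff_space (set_type K) by exact: hausdorff_set_type.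
have cK' : compact [set: set_type K] by exact/compact_set_type.
have [j [cj injj]] := cube_embedding I_inf hK cK' wK.
pose A := f @^-1` range j.
have clA : closed A.
  apply: closed_preimage => //; apply: compact_closed; first exact: hausdorff_cube.
  by apply: continuous_compact => //; exact: continuous_subspaceT.
have /choice[kap kapE] (a : set_type A) : exists k, j k = f (set_val a).
  by have [k _ kE] := set_val_mem a; exists k.
have ckap : continuous kap.
  apply: (continuous_lift_compact (@hausdorff_cube I) cK' cj injj) => a.
  apply: (continuous_ext_at (f := fun a => f (set_val a))); last by move=> z; rewrite /= kapE.
  by apply: (@continuous_comp_at _ _ _ set_val f); [exact: continuous_set_val|exact: cf].
(* [A] is closed in the compact space [Y], so Tietze gives normal placement. *)
have [|G [cG GE]] := conn Y tY eY A kap clA ckap.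
  move=> h ch; have ch' : continuous (fun a => h (set_val (kap a))).
    move=> a; apply: (@continuous_comp_at _ _ _ (fun a => set_val (kap a)) h); last exact: ch.
    exact: continuous_val_comp.
  by have [F cF FE] := tietze_compact hY cY clA ch'; exists F.
(* [G] sends the whole fibre of [f] over [j k] to [k]. Hence any lift to [Y] of a map extending the
   embedded [g] yields, after [G], an extension of [g]. *)
have GK y k : f y = j k -> G y = set_val k.
  move=> yk; have Ay : A y by exists k.
  rewrite (GE (to_set Ay)); congr set_val; apply: injj.
  by rewrite kapE.
have surj := L_invertible_surjective inv.
pose P := range G.
have GP y : P (G y) by exists y.
have cP : compact P by apply: continuous_compact => //; exact: continuous_subspaceT.
have hP : hausdorff_space (set_type P) by exact: hausdorff_set_type.
have cG' : continuous (fun y => to_set (GP y)) by exact: continuous_to_set_type.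
exists P; split=> //; split.
  move=> x Kx; have [y yE] := surj (j (to_set Kx)).
  by exists y => //; rewrite (GK y _ yE).
split.
  apply: (weight_le_image I_inf cY hP cG' _ wY) => p.
  by have [y _ yp] := set_val_mem p; exists y; apply: set_val_injective.
move=> Z tZ eZ B g clB cg np.
pose Q := [set p : set_type P | K (set_val p)].
have clQ : closed Q.
  apply: (closed_preimage (f := set_val)); first exact: continuous_set_val.
  exact: compact_closed.
pose kq (q : set_type Q) : set_type K := to_set (set_val_mem q : K (set_val (set_val q))).
have ckq : continuous kq.
  have cv : continuous (fun q : set_type Q => set_val (set_val q)).
    by apply: continuous_val_comp; exact: continuous_set_val.
  by apply: continuous_to_set_type; exact: cv.
(* Normal placement concerns functions on [P], so each coordinate of [j] is extended from [Q] over
   the compact [P] by Tietze before its composite with [g] is extended over [Z]. *)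
have /choice[H HP] i : exists H : Z -> RR, continuous H /\
    forall b : set_type B, H (set_val b) = set_val (j (kq (g b)) i).
  have cu : continuous (fun q => set_val (j (kq q) i)).
    apply: continuous_val_comp => q.
    apply: (@continuous_comp_at _ _ _ (fun q => j (kq q)) (fun y : tych_cube I => y i)).
      by apply: (@continuous_comp_at _ _ _ kq j); [exact: ckq|exact: cj].
    exact: continuous_proj.
  have [|U cU UE] := tietze_compact hP _ clQ cu; first exact/compact_set_type.
  have [H [cH HE]] := np U cU.
  by exists H; split=> // b; rewrite HE UE.
pose gt z : tych_cube I := fun i => to_unit (H i z).
have cgt : continuous gt.
  apply: continuous_to_ptws => i z.
  apply: (@continuous_comp_at _ _ _ (H i) to_unit); last exact: continuous_to_unit.
  by have [cH _] := HP i; exact: cH.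
have gtE (b : set_type B) : gt (set_val b) = j (kq (g b)).
  by apply/funext => i; rewrite /gt (HP i).2 to_unitK.
have [h [ch hE]] := inv Z tZ eZ gt cgt.
exists (fun z => to_set (GP (h z))); split.
  move=> z; apply: (@continuous_comp_at _ _ _ h (fun y => to_set (GP y))).
    exact: ch.
  exact: cG'.
move=> b; apply: set_val_injective; rewrite to_setK.
by rewrite (GK _ (kq (g b))) ?hE ?gtE.
Qed.

(** The coordinates of [phi] extend over the normal space [L], so normal placement extends
    [phi \o g] to a map [Hv] from [X] to R^m. Then [r \o Hv] extends [g] to a neighbourhood cut out
    by a Urysohn function, and the bound on e-dim does the rest. *)
Lemma subcomplex_connected (S : set (cw_cell C)) :
  finite_subcomplex S -> L_connected L (cw_carrier S).
Proof.
move=> fS X tX eX A g clA cg np.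
have [m [phi [N [r [cphi oN Nr phiN]]]]] := finite_subcomplex_retract l0 fS.
have cS := finite_subcomplex_compact fS.
have /choice[H HP] i : exists H : X -> RR, continuous H /\
    forall a : set_type A, H (set_val a) = phi (set_val (g a)) 0 i.
  have [|F cF FE] := @tietze L (cw_carrier S) (fun x => phi x 0 i) (cw_normal C) fS.2 cS.
    by move=> x; apply: (@continuous_coord_at (subspace _) _ phi); exact: cphi.
  have [H [cH HE]] := np F cF; exists H; split=> // a.
  by rewrite HE FE//; exact: set_val_mem.
pose Hv x : 'rV[RR]_m := \row_i H i x.
have cHv : continuous Hv.
  move=> x; apply: continuous_rV => i.
  have [cH _] := HP i.
  by apply: (continuous_ext_at (cH x)) => z; rewrite mxE.
have HvE (a : set_type A) : Hv (set_val a) = phi (set_val (g a)).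
  by apply/rowP => i; rewrite mxE (HP i).2.
have clphi : closed (phi @` cw_carrier S).
  by apply: compact_closed; [exact: norm_hausdorff|exact: continuous_compact].
have [|eta [ceta _ eta0 eta1]] := normal_urysohn (@pseudometric_normal RR 'rV[RR]_m)
    (open_closedC oN) clphi.
  by apply/seteqP; split=> // v [nN [p /phiN[Np _] pv]]; apply: nN; rewrite -pv.
have [|||||G cG GE] := @edim_extend L X A (r \o Hv) (eta \o Hv) 1 eX.
- exact: clA.
- by move=> x; apply: (@continuous_comp_at _ _ _ Hv eta); [exact: cHv|exact: ceta].
- exact: ltr01.
- move=> x Ax; rewrite /= (HvE (to_set Ax)) eta1//.
  by exists (set_val (g (to_set Ax))) => //; exact: set_val_mem.
- move=> x /= ex; apply: (@continuous_comp_at _ _ _ Hv r); first exact: cHv.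
  have [|nN] := pselect (N (Hv x)); first by move=> /Nr[].
  by rewrite eta0 ?ltxx in ex.
exists G; split=> // a; rewrite GE; last exact: set_val_mem.
by rewrite /= HvE; have [_ ->] := phiN _ (set_val_mem (g a)).
Qed.

Lemma subcomplex_weight (S : set (cw_cell C)) :
  finite_subcomplex S -> weight_le (set_type (cw_carrier S)) I.
Proof.
move=> fS; have [m [phi [N [r [cphi oN Nr phiN]]]]] := finite_subcomplex_retract l0 fS.
have cS := finite_subcomplex_compact fS.
have [b [ob bP]] := rV_countable_base m.
have cphi' : continuous (fun p : set_type (cw_carrier S) => phi (set_val p)).
  exact/within_set_val.
apply: (@weight_le_countable I I_inf _
  (fun k => [set p : set_type (cw_carrier S) | b k (phi (set_val p))])).
  by move=> k; exact: (open_preimage cphi').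
move=> U p oU Up.
have [||||W nW WU] := @compact_fiber_nbhs _ _ [set: set_type (cw_carrier S)]
    (fun p => phi (set_val p)) U (phi (set_val p)) (@norm_hausdorff _ _).
- exact/compact_set_type.
- exact: continuous_subspaceT.
- exact: oU.
- move=> q _ qp; suff -> : q = p by [].
  apply: set_val_injective; have [_ <-] := phiN _ (set_val_mem q).
  by rewrite qp; have [_ ->] := phiN _ (set_val_mem p).
move: nW; rewrite nbhsE => -[V [oV Vp] VW].
have [k [bk kV]] := bP V _ oV Vp.
by exists k; split=> // q /= /kV/VW; exact: WU.
Qed.

Lemma connected_quasi_finite :
  (forall (M : topologicalType) (K : set M),
    tychonoff_sp M -> compact K -> weight_le (set_type K) I -> L_connected L K ->
    exists P : set M, compact P /\ K `<=` P /\ weight_le (set_type P) I /\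
      L_connected L [set p : set_type P | K (set_val p)]) ->
  quasi_finite C.
Proof.
move=> H S fS.
have [P [cP [SP [_ conn]]]] := H L (cw_carrier S) (cw_tychonoff C)
  (finite_subcomplex_compact fS) (subcomplex_weight fS) (subcomplex_connected fS).
have [S' [fS' PS']] := compact_in_finite_subcomplex C cP.
exists S'; split=> //; split.
  (* Inclusion of carriers gives inclusion of cells: the centre of [a] lies in an open cell of [S'],
     and distinct open cells are disjoint. *)
  move=> a Sa; have ax : cw_ocell a (cw_char a 0).
    by exists 0 => //; rewrite odiskE normr0 ltr01.
  have [b S'b bx] : cw_carrier S' (cw_char a 0) by apply/PS'/SP; exists a.
  by rewrite (open_cell_unique ax bx).
move=> X tX eX A g clA cg np.
pose Q' := [set p : set_type (cw_carrier S') | cw_carrier S (set_val p)].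
have gS (a : set_type A) : cw_carrier S (set_val (set_val (g a))) := set_val_mem (g a).
pose g1 (a : set_type A) : set_type [set p : set_type P | cw_carrier S (set_val p)] :=
  to_set (gS a : [set p : set_type P | cw_carrier S (set_val p)] (to_set (SP _ (gS a)))).
have cval2 : continuous (fun q : set_type Q' => set_val (set_val q)).
  by apply: continuous_val_comp; exact: continuous_set_val.
have cg1 : continuous g1.
  have cv : continuous (fun a => set_val (set_val (g a))).
    by apply: continuous_val_comp; exact: continuous_val_comp.
  by do 2 apply: continuous_to_set_type; exact: cv.
have clQ' : closed Q'.
  by apply: (closed_preimage (f := set_val)); [exact: continuous_set_val|exact: fS.2].
have [|G [cG GE]] := conn X tX eX A g1 clA cg1.
  move=> h ch.
  have QP (q : set_type Q') : P (set_val (set_val q)) := SP _ (set_val_mem q).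
  (* [h] is defined on [P], whereas normal placement is assumed for functions on the carrier of
     [S']; the two meet on the carrier of [S], from which Tietze extends. *)
  pose u (q : set_type Q') := h (to_set (QP q)).
  have cu : continuous u.
    move=> q; apply: (@continuous_comp_at _ _ _ (fun q => to_set (QP q)) h);
      last exact: ch.
    have c : continuous (fun q => to_set (QP q)) by exact: continuous_to_set_type.
    exact: c.
  have [||F cF FE] := tietze_compact _ _ clQ' cu.
  - exact: hausdorff_set_type.
  - by apply/compact_set_type; exact: finite_subcomplex_compact.
  have [H' [cH' H'E]] := np F cF; exists H'; split=> // a.
  rewrite H'E FE /u; congr h; exact: set_val_injective.
exists (fun x => to_set (PS' _ (set_val_mem (G x)))); split.
  have cvG : continuous (fun x => set_val (G x)) by exact: continuous_val_comp.
  by apply: continuous_to_set_type; exact: cvG.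
by move=> a; apply: set_val_injective; rewrite to_setK GE.
Qed.

End WithIndex.

End Implications.

Lemma L_connected_empty (L M : topologicalType) (K : set M) :
  (L -> False) -> L_connected L K.
Proof.
move=> nL X tX eX A g _ _ _.
exists (fun x => False_rect _ (edim_empty nL eX x)).
by split=> x; [case: (edim_empty nL eX x)|case: (edim_empty nL eX (set_val x))].
Qed.

Theorem theorem2p1 (L : topologicalType) (C : CW_structure L) (I : Type)
    (I_inf : infinite_set [set: I]) :
  [<-> quasi_finite C;
       forall X : topologicalType, tychonoff_sp X -> edim_le X L ->
         forall (Z : topologicalType) (e : X -> Z), stone_cech e -> edim_le Z L;
       exists (Y : topologicalType) (f : Y -> tych_cube I),
         tychonoff_sp Y /\ compact [set: Y] /\ weight_le Y I /\ edim_le Y L /\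
         continuous f /\ L_invertible L f;
       forall (M : topologicalType) (K : set M),
         tychonoff_sp M -> compact K -> weight_le (set_type K) I -> L_connected L K ->
         exists P : set M, compact P /\ K `<=` P /\ weight_le (set_type P) I /\
           L_connected L [set p : set_type P | K (set_val p)]].
Proof.
(* An empty [L] offers no default value [l0]; it is treated apart, every space with e-dim at most
   [L] then being empty. *)
have [[l0 _]|nL] := pselect (exists l0 : L, True); last first.
  have {}nL : L -> False by move=> l0; apply: nL; exists l0.
  tfae.
  - move=> _ X _ eX Z e [_ [_ [_ [_ [_ [dns _]]]]]]; apply: edim_of_empty => z.
    have [|_ [_ [x _ _]]] := dns setT openT; first by exists z.
    exact: (edim_empty nL eX x).
  - move=> _; have nY (y : set_type (set0 : set (tych_cube I))) : False.
      exact: (set_val_mem y).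
    have cY : compact [set: set_type (set0 : set (tych_cube I))].
      by apply/compact_set_type; exact: compact0.
    exists (set_type (set0 : set (tych_cube I))), set_val; split.
      by apply: compact_tychonoff => // y; case: (nY y).
    split=> //; split.
      by exists (fun=> setT); split=> [i|U y]; [exact: openT|case: (nY y)].
    split; first exact: edim_of_empty.
    split; first exact: continuous_set_val.
    move=> Z _ eZ g _; have nZ := edim_empty nL eZ.
    by exists (fun z => False_rect _ (nZ z)); split=> z; case: (nZ z).
  - move=> _ M K _ cK wK _; exists K; do 3 split=> //.
    exact: L_connected_empty.
  - move=> _ K fK; exists K; split=> //; split=> //.
    exact: L_connected_empty.
tfae.
- exact: quasi_finite_stone_cech.
- exact: stone_cech_universal.
- exact: universal_connected.
- exact: connected_quasi_finite.
Qed.
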